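(* Let $\psi:\mathbb R\to\mathbb R\cup\{\infty\}$ be a closed convex function that is nonnegative, satisfies $\psi(0)=0$, and whose effective domain $\mathrm{dom}(\psi)$ is either $[0,\lambda_{\max})$ for some $\lambda_{\max}\in(0,\infty]$ or $[0,\lambda_{\max}]$ for some $\lambda_{\max}\in(0,\infty)$. Let $\mathcal X=\mathrm{dom}(\psi^* )$, $\Lambda=[0,\lambda_{\max}]$, $g_\lambda$ for $\lambda \in \Lambda$, $\Phi=\{g_\lambda:\lambda\in\Lambda\}$, and the hypothesis $\mathcal P$ of (one-sided) sub-$\psi$ distributions be as defined in the context. Then: (i) A function $f\in\mathcal L^\Phi$ satisfies $\int_{\mathcal X}f\,d\mu\le 0$ for all $\mu\in\mathcal P$ if and only if $$f(x)\le\int_\Lambda g_\lambda(x)\,\pi(d\lambda),\quad x\in\mathrm{dom}(\psi^* ),$$ for some finite nonnegative Borel measure $\pi$ on $\Lambda$. (ii) The set of all e-variables for $\mathcal P$ consists precisely of those $[0,\infty]$-valued measurable functions that are pointwise dominated on $\mathrm{dom}(\psi^* )$ by $$\int_\Lambda e^{\lambda x-\psi(\lambda)}\,\pi(d\lambda)$$ for some Borel probability measure $\pi$ on $\Lambda$, where, if $\lambda_{\max}\notin\mathrm{dom}(\psi)$, the integrand at $\lambda=\lambda_{\max}$ is understood as $\lim_{\lambda\uparrow\lambda_{\max}}e^{\lambda x-\psi(\lambda)}$.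
   Context: The effective domain of a function $\phi:\mathbb R\to\mathbb R\cup\{\infty\}$ is $\mathrm{dom}(\phi)=\{\lambda:\phi(\lambda)<\infty\}$; $\phi$ is closed if its epigraph is closed. The convex conjugate is $\psi^*(x)=\sup_{\lambda\in\mathbb R}\{\lambda x-\psi(\lambda)\}$, $x\in\mathbb R$; under the stated assumptions it is $[0,\infty]$-valued and vanishes for $x\le 0$, so $\mathrm{dom}(\psi^* )$ is an interval containing $(-\infty,0]$. A probability measure $\mu$ on $\mathbb R$ is (one-sided) sub-$\psi$ if $\int_{\mathbb R}e^{\lambda x}\mu(dx)\le e^{\psi(\lambda)}$ for all $\lambda\in\mathrm{dom}(\psi)$. Every sub-$\psi$ distribution is concentrated on $\mathrm{dom}(\psi^* )$, so one takes $\mathcal X=\mathrm{dom}(\psi^* )$ with its Borel $\sigma$-algebra and lets $\mathcal P$ be the set of all probability measures on $\mathcal X$ that are sub-$\psi$. For $\lambda\in\mathrm{dom}(\psi)$ set $g_\lambda(x)=e^{\lambda x-\psi(\lambda)}-1$, $x\in\mathrm{dom}(\psi^* )$; if $\lambda_{\max}\notin\mathrm{dom}(\psi)$, set $g_{\lambda_{\max}}(x)=\lim_{\lambda\uparrow\lambda_{\max}}g_\lambda(x)$ (the limit exists and is finite on $\mathrm{dom}(\psi^* )$). $\Lambda=[0,\lambda_{\max}]$ is a compact subset of $[0,\infty]$ ($\lambda_{\max}$ may equal $\infty$). $\mathcal P$ is equivalently the set of probability measures $\mu$ on $\mathcal X$ with $\int|g_\lambda|d\mu<\infty$ and $\int g_\lambda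 d\mu\le 0$ for all $\lambda\in\Lambda$. $\mathcal L^\Phi$ is the set of real-valued measurable $f$ on $\mathcal X$ with $\int|f|\,d\mu<\infty$ for all $\mu\in\mathcal P$. An e-variable for $\mathcal P$ is a measurable $h:\mathcal X\to[0,\infty]$ with $\int_{\mathcal X}h\,d\mu\le 1$ for all $\mu\in\mathcal P$. *)

(* Defs.v *)
From HB Require Import structures.
From mathcomp Require Import all_boot all_order all_algebra.
From mathcomp Require Import all_classical all_reals all_analysis measurable_realfun.

Set Implicit Arguments.
Unset Strict Implicit.
Unset Printing Implicit Defensive.
Import Order.TTheory GRing.Theory Num.Theory.
Import numFieldNormedType.Exports.

Local Open Scope classical_set_scope.
Local Open Scope ring_scope.

Definition effective_domain {R : realType} (phi : R -> \bar R) : set R :=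
  [set t | (phi t < +oo)%E].

Definition epigraph {R : realType} (phi : R -> \bar R) : set (R * R) :=
  [set p | (phi p.1 <= p.2%:E)%E].

Definition closed_function {R : realType} (phi : R -> \bar R) : Prop :=
  closed (epigraph phi).

(* No indeterminate sum arises for functions that avoid -oo, and the product
   0 * +oo is 0 in \bar R. *)
Definition convex_efunction {R : realType} (phi : R -> \bar R) : Prop :=
  forall t x y : R, 0 <= t <= 1 ->
    (phi (t * x + (1 - t) * y)%R <= t%:E * phi x + (1 - t)%R%:E * phi y)%E.

Definition conjugate {R : realType} (psi : R -> \bar R) (x : R) : \bar R :=
  ereal_sup [set ((t * x)%R%:E - psi t)%E | t in [set: R]].

Definition sample_space {R : realType} (psi : R -> \bar R) : set R :=
  effective_domain (conjugate psi).

Definition sub_psi {R : realType} (psi : R -> \bar R)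
    (mu : probability R R) : Prop :=
  forall t : R, effective_domain psi t ->
    (\int[mu]_x (expR (t * x)%R)%:E <= expeR (psi t))%E.

(* Probability measures on the sample space are represented by the Borel
   probability measures on the line that are concentrated on it; likewise,
   functions on the sample space are represented by functions on the line, of
   which only the values on the sample space are ever used. *)
Definition sub_psi_hypothesis {R : realType} (psi : R -> \bar R) :
    set (probability R R) :=
  [set mu | sub_psi psi mu /\ mu (sample_space psi) = 1%E].

(* Measures on this set are likewise Borel measures on \bar R that vanish off it. *)
Definition param_space {R : realType} (lmax : \bar R) : set (\bar R) :=
  [set l | (0 <= l <= lmax)%E].

(* Extends F from the effective domain of psi to a missing right endpoint l,
   finite or +oo, by the limit of F t as t increases to l. *)
Definition left_extension {R : realType} (psi : R -> \bar R) (F : R -> R)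
    (l : \bar R) : R :=
  if (l \is a fin_num) && (psi (fine l) < +oo)%E then F (fine l)
  else lim (F (fine t) @[t --> within [set t : \bar R | (t < l)%E] (nbhs l)]).

Definition exp_fun {R : realType} (psi : R -> \bar R) (l : \bar R) (x : R) : R :=
  left_extension psi (fun t => expR (t * x - fine (psi t))) l.

Definition g_fun {R : realType} (psi : R -> \bar R) (l : \bar R) (x : R) : R :=
  left_extension psi (fun t => expR (t * x - fine (psi t)) - 1) l.

Definition L_Phi {R : realType} (psi : R -> \bar R) : set (R -> R) :=
  [set f : R -> R | measurable_fun (sample_space psi) f /\
     forall mu, sub_psi_hypothesis psi mu ->
       (\int[mu]_(x in sample_space psi) `|f x|%R%:E < +oo)%E].

Definition e_variables {R : realType} (psi : R -> \bar R) :
    set (R -> \bar R) :=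
  [set h : R -> \bar R | [/\ measurable_fun (sample_space psi) h,
      (forall x, sample_space psi x -> (0 <= h x)%E) &
      forall mu, sub_psi_hypothesis psi mu ->
        (\int[mu]_(x in sample_space psi) h x <= 1)%E]].

(* Main.v *)
(** Bounding a function by a mixture of the g_l or of the e-values
    exp (l x - psi l) is a linear problem in the mixing measure. By the
    Mazur-Orlicz theorem it is solved by a positive functional L with L 1 = 1 on
    the bounded functions of l as soon as every finitely supported measure whose
    pairing with every e-value is at most 1 pairs with h to at most 1. Such a
    measure is nearly a member of the hypothesis: shrink it slightly and put the
    missing mass far to the left, where h is nonnegative. The functional is then
    replaced by the Borel measure nu with quantile function
    u |-> inf {l | u <= L 1_[-oo, l]}. It satisfies L 1_[a, b] <= nu [a, b], and
    that suffices, because closedness and convexity of psi make every superlevel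
    set of l |-> exp (l x - psi l), extended to the missing endpoint, a closed
    interval. Part (i) reduces to the same problem for h = 1 + f / C: since
    measures on the negative half-line with arbitrarily heavy tails belong to
    the hypothesis, an admissible f is bounded below, by - C say, on the negative
    half-line. The converse directions are Tonelli's theorem, with Fatou's lemma
    at the missing endpoint. *)
Require Import Defs.
From HB Require Import structures.
From mathcomp Require Import all_boot all_order all_algebra.
From mathcomp Require Import all_classical all_reals all_analysis measurable_realfun.
From mathcomp Require Import convex ring lra.

Set Implicit Arguments.
Unset Strict Implicit.
Unset Printing Implicit Defensive.
Import Order.TTheory GRing.Theory Num.Theory.
Import numFieldNormedType.Exports.

Local Open Scope classical_set_scope.
Local Open Scope ring_scope.

(** * The Mazur-Orlicz theorem *)

Definition sublinear {R : realType} {V : lmodType R} (p : V -> R) : Prop :=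
  (forall u v, p (u + v) <= p u + p v) /\
  (forall c u, 0 <= c -> p (c *: u) <= c * p u).

(** A pair (v, r) in the cone encodes the constraint r <= L v on the functional L to be found. *)
Definition convex_cone {R : realType} {V : lmodType R} (C : set (V * R)) : Prop :=
  [/\ C (0, 0), (forall a b, C a -> C b -> C (a.1 + b.1, a.2 + b.2)) &
      forall c a, 0 <= c -> C a -> C (c *: a.1, c * a.2)].

Section mazur_orlicz.
Context {R : realType} {V : lmodType R}.
Implicit Types (p q : V -> R) (u v : V) (C : set (V * R)).

Lemma sublinear0 p : sublinear p -> p 0 = 0.
Proof.
move=> [pD pZ]; apply/eqP; rewrite eq_le; apply/andP; split.
  by have := pZ 0 0 (lexx _); rewrite scaler0 mul0r.
by have := pD 0 0; rewrite addr0 lerDl.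
Qed.

Lemma sublinear_ge p u v : sublinear p -> p v - p (- u) <= p (u + v).
Proof. by move=> [pD _]; rewrite lerBlDr; have := pD (u + v) (- u); rewrite addrC addKr. Qed.

Lemma sublinear_ge_opp p u : sublinear p -> - p (- u) <= p u.
Proof.
move=> sp; have := sublinear_ge u 0 sp.
by rewrite (sublinear0 sp) sub0r addr0.
Qed.

(** The function q u = inf over the cone of p (u + a.1) - a.2 absorbs the constraints: an additive L
    <= q satisfies L (- a.1) <= p 0 - a.2 = - a.2. The infimum is finite since p (u + a.1) >= p a.1
    - p (- u) >= a.2 - p (- u). *)
Lemma sublinear_cone p C : sublinear p -> convex_cone C ->
  (forall a, C a -> a.2 <= p a.1) ->
  exists2 q, sublinear q & forall a u, C a -> q u <= p (u + a.1) - a.2.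
Proof.
move=> sp [C0 CD CZ] Cp; have [pD pZ] := sp.
pose S u := [set p (u + a.1) - a.2 | a in C].
have Slb u : lbound (S u) (- p (- u)).
  move=> _ [a Ca <-]; have := sublinear_ge u a.1 sp; have := Cp _ Ca; lra.
have SC a u : C a -> inf (S u) <= p (u + a.1) - a.2.
  by move=> Ca; apply: ge_inf; [exists (- p (- u)) | exists a].
have S0 u : S u !=set0 by exists (p (u + 0) - 0); exists (0, 0).
exists (fun u => inf (S u)); last by move=> a u /SC.
split=> [u v|c u].
  rewrite -lerBlDr; apply: lb_le_inf => // _ [a Ca <-].
  rewrite lerBlDr -lerBlDl; apply: lb_le_inf => // _ [b Cb <-].
  rewrite lerBlDl; have := SC _ (u + v) (CD _ _ Ca Cb); move=> /le_trans; apply.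
  by have := pD (u + a.1) (v + b.1); rewrite addrACA /=; lra.
rewrite le_eqVlt => /predU1P[<-|c0].
  rewrite scale0r mul0r; apply: le_trans (SC (0, 0) 0 C0) _.
  by rewrite /= addr0 subr0 (sublinear0 sp).
rewrite -ler_pdivrMl//; apply: lb_le_inf => // _ [a Ca <-].
rewrite ler_pdivrMl//; apply: le_trans (SC _ _ (CZ _ _ (ltW c0) Ca)) _ => /=.
by rewrite -scalerDr mulrBr lerD2r pZ// ltW.
Qed.

(** Fold the ray through (v, p v) into [p]: the new sublinear function lies below [p], hence equals
    [p] by minimality, and its bound at u reads p u <= p (u + v) - p v. *)
Lemma minimal_sublinear_additive p : sublinear p ->
  (forall q, sublinear q -> (forall u, q u <= p u) -> forall u, q u = p u) ->
  forall u v, p (u + v) = p u + p v.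
Proof.
move=> sp pmin u v; have [pD pZ] := sp.
apply/eqP; rewrite eq_le pD/=.
pose C : set (V * R) := [set (t *: v, t * p v) | t in [set t : R | 0 <= t]].
have cC : convex_cone C.
  split; first by exists 0; rewrite /= ?scale0r ?mul0r.
    move=> _ _ [s s0 <-] [t t0 <-]/=; exists (s + t); first exact: addr_ge0.
    by rewrite scalerDl mulrDl.
  move=> c _ c0 [t t0 <-]/=; exists (c * t); first exact: mulr_ge0.
  by rewrite scalerA mulrA.
have Cp a : C a -> a.2 <= p a.1.
  move=> [t /= t0 <-]/=; move: t0; rewrite le_eqVlt => /predU1P[<-|t0].
    by rewrite scale0r mul0r sublinear0.
  rewrite -ler_pdivlMl//; have := pZ t^-1 (t *: v).
  by rewrite scalerA mulVf ?gt_eqF// scale1r; apply; rewrite invr_ge0 ltW.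
have [q sq qC] := sublinear_cone sp cC Cp.
have qp w : q w <= p w.
  have [C0 _ _] := cC.
  by have := qC _ w C0; rewrite /= addr0 subr0.
have := qC (v, p v) u; rewrite /= pmin// => H; rewrite -lerBrDr; apply: H.
by exists 1; rewrite /= ?ler01 ?scale1r ?mul1r.
Qed.

(** Zorn's lemma: a chain is bounded by its pointwise infimum, which is finite because every
    sublinear q <= p satisfies q u >= - p (- u). *)
Lemma exists_minimal_sublinear p : sublinear p ->
  exists q, [/\ sublinear q, (forall u, q u <= p u) &
    forall r, sublinear r -> (forall u, r u <= q u) -> forall u, r u = q u].
Proof.
move=> sp.
pose P q := sublinear q /\ forall u, q u <= p u.
pose T := {q : V -> R | P q}.
(* The order is reversed, so that maximal elements are minimal functions. *)
pose leT (a b : T) := `[< forall u, sval b u <= sval a u >].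
have [a|a b c|a b|A totA|[q [sq qp]] qmin] := @Zorn T leT.
- by apply/asboolP => u.
- move=> /asboolP ab /asboolP bc; apply/asboolP => u.
  exact: le_trans (bc u) (ab u).
- case: a b => [a pa] [b pb] /asboolP/= ab /asboolP/= ba; apply: eq_exist; apply/funext => u.
  by apply/eqP; rewrite eq_le ab ba.
- have [[a0 Aa0]|A0] := pselect (exists a, A a); last first.
    exists (exist P p (conj sp (fun u => lexx _))) => s As.
    by exfalso; apply: A0; exists s.
  pose S u := [set sval a u | a in A].
  have Slb u : lbound (S u) (- p (- u)).
    move=> _ [[b [sb bp]] Ab <-]/=; apply: le_trans (sublinear_ge_opp u sb).
    by rewrite lerN2.
  have SA a u : A a -> inf (S u) <= sval a u.
    by move=> Aa; apply: ge_inf; [exists (- p (- u)) | exists a].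
  have S0 u : S u !=set0 by exists (sval a0 u); exists a0.
  have sS : sublinear (fun u => inf (S u)) /\ forall u, inf (S u) <= p u.
    split; last by move=> u; apply: le_trans (SA _ u Aa0) _; case: (svalP a0).
    split=> [u v|c u].
      rewrite -lerBlDr; apply: lb_le_inf => // _ [a Aa <-].
      rewrite lerBlDr -lerBlDl; apply: lb_le_inf => // _ [b Ab <-].
      rewrite lerBlDl.
      (* Of two members of the chain, the smaller one serves both arguments. *)
      have [/asboolP ba|/asboolP ab] := totA _ _ Aa Ab.
        apply: le_trans (SA _ _ Ab) _; have [[bD _] _] := svalP b.
        by apply: le_trans (bD _ _) _; rewrite lerD2r.
      apply: le_trans (SA _ _ Aa) _; have [[aD _] _] := svalP a.
      by apply: le_trans (aD _ _) _; rewrite lerD2l.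
    rewrite le_eqVlt => /predU1P[<-|c0].
      rewrite scale0r mul0r; apply: le_trans (SA _ _ Aa0) _.
      by rewrite sublinear0//; case: (svalP a0).
    rewrite -ler_pdivrMl//; apply: lb_le_inf => // _ [a Aa <-].
    rewrite ler_pdivrMl//; apply: le_trans (SA _ _ Aa) _ => /=.
    by have [[_ aZ] _] := svalP a; rewrite aZ// ltW.
  by exists (exist P _ sS) => a Aa; apply/asboolP => u /=; exact: SA.
exists q; split=> // r sr rq u.
have rp v : r v <= p v by apply: le_trans (qp v).
suff /(qmin (exist P r (conj sr rp)))/(congr1 sval)/= -> :
  leT (exist P q (conj sq qp)) (exist P r (conj sr rp)) by [].
exact/asboolP.
Qed.

(** A minimal function below the [q] of [sublinear_cone] is additive, hence odd, and its value at -
    a.1 yields the constraint of the cone. *)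
Lemma mazur_orlicz p C : sublinear p -> convex_cone C ->
  (forall a, C a -> a.2 <= p a.1) ->
  exists L : V -> R, [/\ forall u v, L (u + v) = L u + L v,
    forall c u, 0 <= c -> L (c *: u) = c * L u,
    forall u, L u <= p u & forall a, C a -> a.2 <= L a.1].
Proof.
move=> sp cC Cp.
have [q sq qC] := sublinear_cone sp cC Cp.
have [L [sL Lq Lmin]] := exists_minimal_sublinear sq.
have LD := minimal_sublinear_additive sL Lmin.
have LN u : L (- u) = - L u.
  by apply/eqP; rewrite -addr_eq0 -LD addNr sublinear0.
exists L; split=> //.
- move=> c u c0; apply/eqP; rewrite eq_le (sL.2 _ _ c0)/=.
  by have := sL.2 c (- u) c0; rewrite scalerN !LN mulrN lerN2.
- move=> u; apply: le_trans (Lq u) _; have [C0 _ _] := cC.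
  by have := qC _ u C0; rewrite /= addr0 subr0.
- move=> a Ca; have := le_trans (Lq (- a.1)) (qC _ (- a.1) Ca).
  by rewrite addNr (sublinear0 sp) sub0r LN lerN2.
Qed.

End mazur_orlicz.

(** * From positive functionals to measures *)

Section bounded_functions.
Context {T : Type} {R : realType}.

Definition bounded_pred : {pred T -> R} :=
  fun f => `[< exists M, forall x, `|f x| <= M >].

Lemma bounded_predP (f : T -> R) :
  reflect (exists M, forall x, `|f x| <= M) (f \in bounded_pred).
Proof. exact: asboolP. Qed.

Lemma bounded_submod_closed : submod_closed bounded_pred.
Proof.
split; first by apply/bounded_predP; exists 0 => x; rewrite normr0.
move=> c f g /bounded_predP[M fM] /bounded_predP[N gN]; apply/bounded_predP.
exists (`|c| * M + N) => x; apply: le_trans (ler_normD _ _) _.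
by rewrite lerD// normrM ler_wpM2l.
Qed.

HB.instance Definition _ :=
  GRing.isSubmodClosed.Build R (T -> R) bounded_pred bounded_submod_closed.

Record bfun := BFun { bfun_val :> T -> R; bfunP : bfun_val \in bounded_pred }.

HB.instance Definition _ := [isSub for bfun_val].
HB.instance Definition _ := [Choice of bfun by <:].
HB.instance Definition _ := [SubChoice_isSubLmodule of bfun by <:].

End bounded_functions.
Arguments bfun : clear implicits.
Section bounded_functions_theory.
Context {T : Type} {R : realType}.
Lemma bfunD (f g : bfun T R) x : (f + g) x = f x + g x.
Proof. by []. Qed.
Lemma bfunZ c (f : bfun T R) x : (c *: f) x = c * f x.
Proof. by []. Qed.
Lemma bfunN (f : bfun T R) x : (- f) x = - f x.
Proof. by []. Qed.
End bounded_functions_theory.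

(** * Counting the integers below a real number *)

Section staircase.
Context {R : realType}.

(** The sum counts the integers among 1, ..., n that are at most y: the floor of y, capped at n. *)
Lemma staircase_le (n : nat) (y : R) : 0 <= y ->
  \sum_(k < n) (k.+1%:R <= y)%R%:R <= y.
Proof.
elim: n => [|n IHn] y0; first by rewrite big_ord0.
rewrite big_ord_recr/=; case: (leP n.+1%:R y) => [ny|_]; last by rewrite addr0 IHn.
apply: le_trans ny; rewrite -addn1 natrD lerD2r.
have -> : n%:R = \sum_(k < n) 1 :> R by rewrite sumr_const card_ord.
by apply: ler_sum => k _; rewrite lern1 leq_b1.
Qed.

Lemma staircase_ge (n : nat) (y : R) : y <= n%:R ->
  y - 1 <= \sum_(k < n) (k.+1%:R <= y)%R%:R.
Proof.
elim: n => [|n IHn] yn; first by rewrite big_ord0 subr_le0 (le_trans yn).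
rewrite big_ord_recr/=; have [{}yn|ny] := leP y n%:R.
  by apply: le_trans (IHn yn) _; rewrite lerDl.
apply: (@le_trans _ _ n%:R); first by rewrite lerBlDr natr1.
have -> : \sum_(k < n) (k.+1%:R <= y)%R%:R = n%:R :> R.
  rewrite (eq_bigr (fun=> 1)) ?sumr_const ?card_ord// => k _.
  by rewrite (le_trans _ (ltW ny))// ler_nat.
by rewrite lerDl.
Qed.

End staircase.

(** * The probability measure attached to a positive functional *)

Section positive_functional.
Context {R : realType}.
Variables (l0 l1 : \bar R) (l01 : (l0 <= l1)%E).
Local Notation Lam := [set l : \bar R | (l0 <= l <= l1)%E].
Local Notation V := (bfun (\bar R) R).

Lemma cst_bounded (c : R) : (fun=> c : R) \in @bounded_pred (\bar R) R.
Proof. by apply/bounded_predP; exists `|c|. Qed.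

Lemma indic_bounded (A : set (\bar R)) : (\1_A : _ -> R) \in bounded_pred.
Proof.
by apply/bounded_predP; exists 1 => x; rewrite indicE; case: (_ \in _); rewrite ?normr1 ?normr0.
Qed.

Definition bcst c : V := BFun (cst_bounded c).
Definition bindic A : V := BFun (indic_bounded A).

(** Domination by this gauge makes a linear functional positive, normalized and blind to values off
    [Lam]. *)
Definition supL (f : V) : R := sup [set f l | l in Lam].

Lemma supL_ub (f : V) l : Lam l -> f l <= supL f.
Proof.
move=> Ll; apply: ub_le_sup; last by exists l.
have /bounded_predP[M fM] := bfunP f.
by exists M => _ [k _ <-]; apply: le_trans (fM k); rewrite ler_norm.
Qed.

Lemma supL_le (f : V) c : (forall l, Lam l -> f l <= c) -> supL f <= c.
Proof.
move=> fc; apply: ge_sup; first by exists (f l0); exists l0; rewrite //= lexx.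
by move=> _ [k /fc ? <-].
Qed.

Lemma supL_sublinear : sublinear supL.
Proof.
split=> [f g|c f c0].
  by apply: supL_le => l Ll; rewrite bfunD lerD// supL_ub.
by apply: supL_le => l Ll; rewrite bfunZ ler_wpM2l// supL_ub.
Qed.

Variable L : V -> R.
Hypothesis LD : forall u v, L (u + v) = L u + L v.
Hypothesis LZ : forall c u, 0 <= c -> L (c *: u) = c * L u.
Hypothesis Lsup : forall u, L u <= supL u.

Lemma functional_le (f g : V) : (forall l, Lam l -> f l <= g l) -> L f <= L g.
Proof.
move=> fg; have -> : f = (f - g) + g by rewrite subrK.
rewrite LD -[leRHS]add0r lerD2r; apply: le_trans (Lsup _) _.
by apply: supL_le => l Ll; rewrite bfunD bfunN subr_le0 fg.
Qed.

Lemma functional_cst c : L (bcst c) <= c.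
Proof. by apply: le_trans (Lsup _) _; exact: supL_le. Qed.

Lemma functional0 : L 0 = 0.
Proof. by have := LZ (0 : V) (lexx 0); rewrite scale0r mul0r. Qed.

Lemma functional_sum n (F : nat -> V) : L (\sum_(k < n) F k) = \sum_(k < n) L (F k).
Proof.
elim: n => [|n IHn]; last by rewrite !big_ord_recr/= LD IHn.
by rewrite !big_ord0 functional0.
Qed.

Definition lower_mass (l : \bar R) : R := L (bindic [set k | (k <= l)%E]).

(* Under the uniform law on [0, 1], this function has the distribution that L
   assigns to half-lines, regularized into a measure. *)
Definition quantile (u : R) : \bar R := ereal_inf [set l | u <= lower_mass l].

Lemma quantile_nd (u v : R) : u <= v -> (quantile u <= quantile v)%E.
Proof. by move=> uv; apply: ereal_inf_le_tmp => l /=; exact: le_trans. Qed.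

Lemma measurable_quantile :
  @measurable_fun _ _ (measurableTypeR R) (\bar R) setT quantile.
Proof.
apply: (measurability _ (ErealGenCInfty.measurableE R)) => _ [_ [r ->] <-].
apply: measurableI => //; apply: is_interval_measurable => s t/=.
rewrite !in_itv/= !andbT => fs ft u /andP[su ut].
by rewrite in_itv/= andbT (le_trans fs)// quantile_nd.
Qed.

(** Inverse transform sampling: [L] is only finitely additive, but the law of a random variable is a
    genuine measure. *)
Definition functional_prob : probability (\bar R) R :=
  distribution (uniform_prob (@ltr01 R))
    (@mfun_Sub _ _ (measurableTypeR R) (\bar R) quantile
      (mem_set measurable_quantile)).

(** With m = L 1_[a, b], each u in ]lower_mass b - m, lower_mass b], an interval of length m inside
    [0, 1], has its quantile in [a, b]: a point l < a satisfies lower_mass l + m <= lower_mass b < u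
    + m. *)
Lemma functional_prob_itv (a b : \bar R) :
  ((L (bindic [set l | (a <= l <= b)%E]))%:E <=
   functional_prob [set l | (a <= l <= b)%E])%E.
Proof.
set I := [set l | _]; set m := L (bindic I).
have m0 : 0 <= m.
  by rewrite -functional0; apply: functional_le => l _ /=; rewrite indicE.
have mb : m <= lower_mass b.
  apply: functional_le => l _; rewrite /= !indicE ler_nat.
  by case: (boolP (l \in I)) => //; rewrite !inE/= => /andP[_ lb]; rewrite mem_set.
have b1 : lower_mass b <= 1.
  apply: le_trans (functional_cst 1); apply: functional_le => l _ /=.
  by rewrite indicE; case: (_ \in _).
have -> : functional_prob I = uniform_prob (@ltr01 R) (quantile @^-1` I) by [].
apply: (@le_trans _ _ (uniform_prob (@ltr01 R)
   `](lower_mass b - m), (lower_mass b)]%classic)).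
  rewrite /uniform_prob (eq_integral (cst 1%E)); last first.
    move=> u; rewrite inE/= in_itv/= => /andP[u1 u2]; rewrite /uniform_pdf.
    rewrite subr0 invr1 ifT// (le_trans u2 b1) andbT.
    by apply: le_trans (ltW u1); rewrite subr_ge0.
  rewrite integral_cst//= mul1e lebesgue_measure_itv/= lte_fin ltrBlDr ltrDl.
  case: ltP => [_|]; first by rewrite -EFinB lee_fin opprB addrC subrK.
  by rewrite -lee_fin.
apply: le_measure; rewrite ?inE//.
  rewrite -[X in measurable X]setTI; apply: measurable_quantile => //.
  exact: (emeasurable_itv `[a, b]).
move=> u /=; rewrite in_itv/= => /andP[u1 u2]; apply/andP; split; last first.
  exact: ereal_inf_lbound.
(* If b < a, the indicator vanishes, so m <= 0 and no u is left. *)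
have [ab|ba] := leP a b; last first.
  have : m <= 0.
    rewrite -functional0; apply: functional_le => l _ /=.
    rewrite indicE memNset//= => /andP[al lb].
    by move: (le_trans al lb); rewrite leNgt ba.
  by rewrite real_leNgt ?num_real// => /negP; elim; lra.
apply: le_ereal_inf_tmp => l /= ul; rewrite leNgt; apply/negP => la.
have : lower_mass l + m <= lower_mass b.
  rewrite -LD; apply: functional_le => k _; rewrite bfunD/= !indicE -natrD ler_nat.
  have lb : (l <= b)%E by rewrite (le_trans (ltW la)).
  case: (boolP (k \in [set l | (a <= l <= b)%E])) => [|_].
    rewrite inE/= => /andP[ak kb]; rewrite memNset ?mem_set//=.
    by apply/negP; rewrite -ltNge (lt_le_trans la).
  case: (boolP (k \in _)) => //; rewrite inE/= => kl; rewrite mem_set//=.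
  exact: le_trans lb.
lra.
Qed.

Lemma functional_prob_support : functional_prob (~` Lam) = 0%E.
Proof.
have mLam : measurable Lam by exact: (emeasurable_itv `[l0, l1]).
rewrite probability_setC// (_ : functional_prob Lam = 1%E) ?subee//.
apply/eqP; rewrite eq_le probability_le1//=.
apply: le_trans (functional_prob_itv l0 l1); rewrite lee_fin.
(* The function 1_Lam - 1 vanishes on [Lam], hence - L 1_Lam <= L (-1) <= -1. *)
rewrite -[leLHS]opprK lerNl; apply: le_trans (functional_cst (-1)).
rewrite -[X in X <= _]add0r -lerBrDr opprK -LD -functional0.
by apply: functional_le => l Ll; rewrite bfunD/= indicE mem_set//= addrC subrr.
Qed.

End positive_functional.

(** * Measurability and integrals from superlevel intervals *)

Section superlevel.
Context {R : realType}.

Lemma measurable_superlevel (D : set (\bar R)) (f : \bar R -> R) :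
  measurable D -> (forall l, D l -> 0 <= f l) ->
  (forall s, 0 < s -> exists a b, D `&` [set l | s <= f l] = [set l | (a <= l <= b)%E]) ->
  measurable_fun D f.
Proof.
move=> mD f0 fs _.
apply: (measurability _ (RGenCInfty.measurableE R)) => // _ [_ [s ->] <-].
have [s0|s0] := ltP 0 s.
  have [a [b Dab]] := fs s s0.
  rewrite (_ : _ `&` _ = [set l | (a <= l <= b)%E]).
    exact: (emeasurable_itv `[a, b]).
  by rewrite -Dab; congr (_ `&` _); apply/seteqP; split=> l /=; rewrite in_itv/= andbT.
rewrite (_ : _ `&` _ = D)//; apply/seteqP; split=> [l []//|l Dl]; split=> //=.
by rewrite in_itv/= andbT (le_trans s0)// f0.
Qed.

End superlevel.

Section layer_cake.
Context {R : realType}.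
Variables (l0 l1 : \bar R) (l01 : (l0 <= l1)%E).
Local Notation Lam := [set l : \bar R | (l0 <= l <= l1)%E].
Local Notation V := (bfun (\bar R) R).
Variable L : V -> R.
Hypothesis LD : forall u v, L (u + v) = L u + L v.
Hypothesis LZ : forall c u, 0 <= c -> L (c *: u) = c * L u.
Hypothesis Lsup : forall u, L u <= supL l0 l1 u.

(* [L phi] and the integral are both compared with the staircase
   B/n \sum_k 1_{phi >= (k+1)B/n}. *)
Lemma functional_le_integral (phi : V) :
  (forall l, Lam l -> 0 <= phi l) ->
  (forall s, 0 < s -> exists a b,
     Lam `&` [set l | s <= phi l] = [set l | (a <= l <= b)%E]) ->
  ((L phi)%:E <= \int[functional_prob L]_(l in Lam) (phi l)%:E)%E.
Proof.
move=> phi0 phis; set nu := functional_prob L.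
have mLam : measurable Lam by exact: (emeasurable_itv `[l0, l1]).
have mphi : measurable_fun Lam phi by exact: measurable_superlevel.
have [B B0 phiB] : exists2 B, 0 < B & forall l, phi l <= B.
  have /bounded_predP[M fM] := bfunP phi.
  exists (M + 1) => [|l]; last first.
    by apply: le_trans (ler_norm _) _; apply: le_trans (fM l) _; rewrite lerDl.
  by rewrite ltr_wpDl//; apply: le_trans (fM l0).
pose d n := B / n.+1%:R.
have d0 n : 0 < d n by rewrite divr_gt0.
pose S n k := Lam `&` [set l | d n * k.+1%:R <= phi l].
have mS n k : measurable (S n k).
  rewrite /S; have [a [b ->]] := phis (d n * k.+1%:R) (mulr_gt0 (d0 n) (ltr0Sn _ _)).
  exact: (emeasurable_itv `[a, b]).
(* The shape of the superlevel sets enters here: on intervals the measure dominates [L]. *)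
have LS n k : ((L (bindic (S n k)))%:E <= nu (S n k))%E.
  have [a [b Sab]] := phis (d n * k.+1%:R) (mulr_gt0 (d0 n) (ltr0Sn _ _)).
  by rewrite /S Sab; exact: (functional_prob_itv l01).
have SE n k l : Lam l -> \1_(S n k) l = (k.+1%:R <= phi l / d n)%R%:R :> R.
  move=> Ll; rewrite indicE ler_pdivlMr// mulrC; congr (_%:R); congr nat_of_bool.
  by apply/idP/idP => [/set_mem[]//|dl]; apply/mem_set; split.
have Lphi n : L phi <= d n + d n * \sum_(k < n.+1) L (bindic (S n k)).
  rewrite -(functional_sum LD LZ _ (fun k => bindic (S n k))) -LZ; last exact: ltW.
  apply: (@le_trans _ _ (L (bcst (d n)) + L (d n *: \sum_(k < n.+1) bindic (S n k)))).
    rewrite -LD; apply: (functional_le l01 LD Lsup) => l Ll.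
    have -> : (bcst (d n) + d n *: \sum_(k < n.+1) bindic (S n k)) l =
        d n + d n * \sum_(k < n.+1) (k.+1%:R <= phi l / d n)%R%:R.
      rewrite bfunD bfunZ/=; congr (_ + _ * _).
      under [RHS]eq_bigr do rewrite -(SE _ _ _ Ll).
      elim/big_rec2 : _ => // k _ x _ <-; exact: bfunD.
    rewrite -lerBlDl -ler_pdivrMl// mulrBr mulVf ?gt_eqF// mulrC.
    (* The n + 1 steps of height d n reach the bound [B], so the staircase misses [phi] by at most d
       n. *)
    apply: staircase_ge; rewrite ler_pdivrMr// /d mulrCA divff ?pnatr_eq0//.
    by rewrite mulr1.
  by rewrite lerD2r; exact: (functional_cst l01).
have nuphi n : ((d n * \sum_(k < n.+1) L (bindic (S n k)))%:E <=
    \int[nu]_(l in Lam) (phi l)%:E)%E.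
  rewrite EFinM -sumEFin.
  apply: (@le_trans _ _ ((d n)%:E * \sum_(k < n.+1) nu (S n k))%E).
    by apply: lee_wpmul2l; [rewrite lee_fin ltW | exact: lee_sum].
  apply: (@le_trans _ _ (\int[nu]_(l in Lam) ((d n)%:E * (\sum_(k < n.+1) (\1_(S n k) l)%:E)))%E).
    rewrite ge0_integralZl_EFin//; first last.
    - exact: ltW.
    - apply: emeasurable_sum => k; apply/measurable_EFinP.
      exact: measurable_indic.
    - by move=> l _; apply: sume_ge0 => k _; rewrite lee_fin.
    rewrite ge0_integral_sum//; last first.
      by move=> k; apply/measurable_EFinP; exact: measurable_indic.
    apply: lee_wpmul2l; first by rewrite lee_fin ltW.
    apply: lee_sum => k _.
    by rewrite integral_indic// setIidl// => l [].
  apply: ge0_le_integral => //.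
  - move=> l _; rewrite mule_ge0//; first by rewrite lee_fin ltW.
    by apply: sume_ge0 => k _; rewrite lee_fin.
  - apply: measurable_funeM; apply: emeasurable_sum => k; apply/measurable_EFinP.
    exact: measurable_indic.
  - exact/measurable_EFinP.
  - move=> l Ll; rewrite sumEFin -EFinM lee_fin.
    rewrite (eq_bigr (fun k : 'I_n.+1 => (k.+1%:R <= phi l / d n)%R%:R)); last first.
      by move=> k _; exact: SE.
    rewrite -ler_pdivlMl// mulrC; apply: staircase_le.
    by apply: mulr_ge0; [rewrite invr_ge0 ltW | exact: phi0].
apply/lee_addgt0Pr => e e0.
have [n ne] : exists n, d n <= e.
  exists (Num.bound (B / e)); rewrite /d ler_pdivrMr// -ler_pdivrMl// mulrC.
  rewrite (le_trans (ltW (archi_boundP _)))// ?ler_nat//.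
  by rewrite divr_ge0// ltW.
apply: (@le_trans _ _ ((d n)%:E + (d n * \sum_(k < n.+1) L (bindic (S n k)))%:E)%E).
  by rewrite -EFinD lee_fin.
by rewrite addeC leeD// lee_fin.
Qed.

End layer_cake.

(** * Domination by a mixture *)

Section dominating_mixture.
Context {R : realType} {I : eqType}.
Variables (l0 l1 : \bar R) (l01 : (l0 <= l1)%E).
Local Notation Lam := [set l : \bar R | (l0 <= l <= l1)%E].
Variables (X : set I) (E : \bar R -> I -> R) (h : I -> R).

(** The cone pairs each nonnegative combination of the functions l |-> E l x with the same
    combination of the values h x; the third hypothesis says that it lies below the supremum
    gauge. *)
Lemma dominating_mixture :
  (forall x, X x -> exists B, forall l, Lam l -> 0 <= E l x <= B) ->
  (forall x, X x -> forall s, 0 < s -> exists a b,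
     Lam `&` [set l | s <= E l x] = [set l | (a <= l <= b)%E]) ->
  (forall (s : seq (R * I)) c, {in s, forall a, 0 <= a.1 /\ X a.2} ->
     (forall l, Lam l -> \sum_(a <- s) a.1 * E l a.2 <= c) ->
     \sum_(a <- s) a.1 * h a.2 <= c) ->
  exists2 nu : probability (\bar R) R, nu (~` Lam) = 0%E &
    forall x, X x -> ((h x)%:E <= \int[nu]_(l in Lam) (E l x)%:E)%E.
Proof.
move=> EB Es Eh.
(* The cut-off makes the function bounded on all of \bar R, not just on [Lam]. *)
pose e x (l : \bar R) : R := if `[< X x /\ Lam l >] then E l x else 0.
have eE x l : X x -> Lam l -> e x l = E l x.
  by move=> Xx Ll; rewrite /e; case: asboolP => // -[].
have eb x : e x \in bounded_pred.
  apply/bounded_predP; have [Xx|nXx] := pselect (X x); last first.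
    by exists 0 => l; rewrite /e; case: asboolP => [[]//|_]; rewrite normr0.
  have [B EBx] := EB x Xx; exists `|B| => l; rewrite /e; case: asboolP => [[_ Ll]|_].
    have /andP[E0 EB'] := EBx l Ll.
    by rewrite ger0_norm// (le_trans EB')// ler_norm.
  by rewrite normr0.
pose T x : bfun (\bar R) R := BFun (eb x).
pose ST (s : seq (R * I)) := \sum_(a <- s) a.1 *: T a.2.
pose Sh (s : seq (R * I)) := \sum_(a <- s) a.1 * h a.2.
pose good (s : seq (R * I)) := {in s, forall a, 0 <= a.1 /\ X a.2}.
have STE s l : good s -> Lam l -> ST s l = \sum_(a <- s) a.1 * E l a.2.
  move=> gs Ll; rewrite /ST !big_seq.
  elim/big_rec2 : _ => // a x y /gs[_ Xa] <-.
  by rewrite bfunD bfunZ/= eE.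
pose C := [set (ST s, Sh s) | s in good].
have cC : convex_cone C.
  split.
  - by exists [::]; [by []|rewrite /ST /Sh !big_nil].
  - move=> _ _ [s gs <-] [t gt <-]/=; exists (s ++ t).
      by move=> a; rewrite mem_cat => /orP[/gs|/gt].
    by rewrite /ST /Sh !big_cat.
  - move=> c _ c0 [s gs <-]/=; exists [seq (c * a.1, a.2) | a <- s].
      by move=> _ /mapP[a /gs[a0 Xa] ->]; split=> //; exact: mulr_ge0.
    rewrite /ST /Sh !big_map scaler_sumr mulr_sumr; congr (_, _).
      by apply: eq_bigr => a _ /=; rewrite scalerA.
    by apply: eq_bigr => a _ /=; rewrite mulrA.
have Cp a : C a -> a.2 <= supL l0 l1 a.1.
  move=> [s gs <-]/=; apply: Eh => // l Ll.
  by rewrite -STE//; exact: supL_ub.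
have [L [LD LZ Lp LC]] := mazur_orlicz (supL_sublinear l01) cC Cp.
exists (functional_prob L); first exact: (functional_prob_support l01 LD LZ Lp).
move=> x Xx.
have hL : h x <= L (T x).
  have := LC (T x, h x); apply.
  exists [:: (1, x)]; first by move=> a; rewrite inE => /eqP ->.
  by rewrite /ST /Sh !big_seq1 scale1r mul1r.
apply: (@le_trans _ _ (L (T x))%:E); first by rewrite lee_fin.
rewrite (eq_integral (fun l => (T x l)%:E)); last first.
  by move=> l; rewrite inE => Ll; rewrite /= eE.
apply: (functional_le_integral l01 LD LZ Lp).
  move=> l Ll; have [B EBx] := EB x Xx.
  by rewrite /= eE//; have /andP[] := EBx l Ll.
move=> s s0; have [a [b Eab]] := Es x Xx s s0; exists a, b; rewrite -Eab.
by apply/seteqP; split=> l [Ll sl]; split=> //; move: sl; rewrite /= eE.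
Qed.

End dominating_mixture.

(** * Left limits of quasiconcave functions *)

Section real_closed_sets.
Context {R : realType}.

Lemma closed_sup (A : set R) : A !=set0 -> has_ubound A -> closed A -> A (sup A).
Proof. by move=> A0 Aub Ac; apply: Ac; exact: closure_sup. Qed.

Lemma closed_inf (A : set R) : A !=set0 -> has_lbound A -> closed A -> A (inf A).
Proof.
move=> A0 Alb Ac; apply: Ac => B /nbhs_ballP[e /= e0 eB].
have [x Ax xe] := inf_adherent e0 (conj A0 Alb).
exists x; split=> //; apply: eB; rewrite /ball/= distrC ger0_norm ?subr_ge0; last exact: ge_inf.
by rewrite ltrBlDl.
Qed.

End real_closed_sets.

Section left_limit.
Context {R : realType}.
Variable lmax : \bar R.
Hypothesis lmax_gt0 : (0 < lmax)%E.
Local Notation D := [set t : R | (0 <= t%:E < lmax)%E].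

(** An epsilon form of the limit from the left at [lmax], the same for a finite endpoint and for
    +oo. *)
Definition left_limit (f : R -> R) (c : R) := forall e, 0 < e ->
  exists2 a, D a & forall t, D t -> a <= t -> `|f t - c| < e.

Lemma below_lmax0 : D 0.
Proof. by rewrite /= lexx. Qed.

Lemma below_lmax_le (s t : R) : 0 <= s -> s <= t -> D t -> D s.
Proof.
move=> s0 st /andP[_ tl]; rewrite /= lee_fin s0/=.
by rewrite (le_lt_trans _ tl)// lee_fin.
Qed.

Lemma below_lmax_max (s t : R) : D s -> D t -> D (Num.max s t).
Proof. by move=> Ds Dt; rewrite /Num.max; case: ifP. Qed.

(** A sequence in [D] tending to [lmax], along which measurability and Fatou's lemma reach the
    missing endpoint. *)
Definition left_seq (n : nat) : R :=
  if lmax is r%:E then r * (1 - n.+1%:R^-1) else n%:R.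

Lemma left_seqD n : D (left_seq n).
Proof.
rewrite /left_seq/=; case: lmax lmax_gt0 => [r|_|//]; last first.
  by rewrite ltry lee_fin ler0n.
rewrite lte_fin lee_fin lte_fin => r0; apply/andP; split.
  by apply: mulr_ge0; [exact: ltW | rewrite subr_ge0 invf_le1// ler1n].
by rewrite gtr_pMr// ltrBlDr ltrDl invr_gt0.
Qed.

Lemma left_seq_ge a : D a -> \forall n \near \oo, a <= left_seq n.
Proof.
rewrite /left_seq/=; case: lmax lmax_gt0 => [r|_ _|//]; last exact: nbhs_infty_ger.
rewrite !lte_fin lee_fin => r0 /andP[a0 ar].
near=> n; rewrite mulrBr mulr1 lerBrDr -lerBrDl ler_pdivrMr//.
rewrite -ler_pdivrMl ?subr_gt0//.
apply: (@le_trans _ _ n%:R); last by rewrite ler_nat.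
by near: n; exact: nbhs_infty_ger.
Unshelve. all: by end_near. Qed.

Lemma left_seq_cvg f c : left_limit f c -> f (left_seq n) @[n --> \oo] --> c.
Proof.
move=> fc; apply/cvgrPdist_lt => e e0; have [a Da ae] := fc e e0.
have := left_seq_ge Da; apply: filterS => n an; rewrite distrC.
by apply: ae => //; exact: left_seqD.
Qed.

Lemma left_limitB1 f c : left_limit f c -> left_limit (fun t => f t - 1) (c - 1).
Proof.
move=> fc e /fc[a Da ae]; exists a => // t Dt at_.
by have := ae t Dt at_; rewrite opprB addrA subrK.
Qed.

Lemma near_left a : D a ->
  \forall t \near within [set t | (t < lmax)%E] (nbhs lmax), D (fine t) /\ a <= fine t.
Proof.
move=> /= /andP[a0 al].
have : nbhs lmax [set t | (a%:E < t)%E].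
  by apply: open_nbhs_nbhs; split=> //; exact: open_ereal_gt_ereal.
apply: filterS => -[t|_|//] /=; last by rewrite ltNge leey.
rewrite lte_fin => lt_at tl; split; last exact: ltW.
by rewrite tl andbT (le_trans a0)// lee_fin ltW.
Qed.

(** Properness makes limits unique, so that [lim] returns the value found by the epsilon
    argument. *)
Lemma left_proper : ProperFilter (within [set t | (t < lmax)%E] (nbhs lmax)).
Proof.
apply: Build_ProperFilter; rewrite /within/= => nA.
have [t At tl] : exists2 t, ((t < lmax)%E -> set0 t) & (t < lmax)%E.
  move: lmax_gt0 nA; case: lmax => [r|//|//].
    move=> _ nA.
    have /nbhs_ballP[e /= e0 re] : nbhs r (fun t => (t%:E < r%:E)%E -> @set0 (\bar R) t%:E) := nA.
    exists (r - e / 2)%:E.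
      by apply: re; rewrite -ball_normE/= opprB addrC subrK gtr0_norm ?divr_gt0//; lra.
    by rewrite lte_fin ltrBlDr ltrDl divr_gt0.
  move=> _ [M [_ MA]]; exists (M + 1)%:E; last exact: ltry.
  by apply: MA; rewrite lte_fin ltrDl.
exact: At tl.
Qed.

Lemma left_limit_lim (f : R -> R) c : left_limit f c ->
  lim (f (fine t) @[t --> within [set t : \bar R | (t < lmax)%E] (nbhs lmax)]) = c.
Proof.
move=> fc; have FF := left_proper; apply: cvg_lim => //.
apply/cvgrPdist_lt => e e0; have [a Da ae] := fc e e0.
have := near_left Da; apply: filterS => t [Dt at_]; rewrite distrC.
exact: ae.
Qed.

Lemma left_limit_bounds (f : R -> R) c B : (forall t, D t -> 0 <= f t <= B) ->
  left_limit f c -> 0 <= c <= B.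
Proof.
move=> fB fc; apply/andP; split; rewrite leNgt; apply/negP => cB.
  have [|a Da /(_ a Da (lexx _))] := fc (- c); first by rewrite oppr_gt0.
  by have /andP[f0 _] := fB a Da; rewrite ltr_norml => /andP[]; lra.
have [|a Da /(_ a Da (lexx _))] := fc (c - B); first by rewrite subr_gt0.
by have /andP[_ f1] := fB a Da; rewrite ltr_norml => /andP[]; lra.
Qed.

Definition quasiconcave (f : R -> R) := forall a b c, D a -> D c -> a <= b <= c ->
  forall s, s <= f a -> s <= f c -> s <= f b.

(** Otherwise the level min (f a) (f c) would be reached at a and c but not at b. *)
Lemma quasiconcave_after_drop f a b c : quasiconcave f -> D a -> D c ->
  a <= b <= c -> f b < f a -> f c <= f b.
Proof.
move=> fq Da Dc abc ba; rewrite leNgt; apply/negP => bc.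
have := fq a b c Da Dc abc (Num.min (f a) (f c)).
by rewrite !ge_min !lexx orbT => /(_ isT isT); rewrite !leNgt ba bc.
Qed.

(** Either [f] never drops and is nondecreasing on [D], or it is nonincreasing from the end of some
    drop on; being bounded, it converges in both cases. *)
Lemma exists_left_limit f B : (forall t, D t -> 0 <= f t <= B) -> quasiconcave f ->
  exists c, left_limit f c.
Proof.
move=> fB fq.
have [[a [b [Da Db ab fab]]]|nd] :=
    pselect (exists a b, [/\ D a, D b, a <= b & f b < f a]).
  (* If f s < f a, then s itself ends a drop from a; otherwise f b < f a <= f s contradicts f s <= f
     b. *)
  have noninc s t : D t -> b <= s -> s <= t -> f t <= f s.
    move=> Dt bs st; have [sa|as_] := ltP (f s) (f a).
      by apply: (quasiconcave_after_drop fq Da Dt) => //; rewrite st (le_trans ab).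
    have Ds : D s by apply: below_lmax_le st Dt; apply: le_trans bs; case/andP: Db.
    have : f s <= f b by apply: (quasiconcave_after_drop fq Da Ds) => //; rewrite ab bs.
    by rewrite leNgt => /negP; elim; exact: lt_le_trans as_.
  pose S := [set f t | t in D `&` [set t | b <= t]].
  have S0 : S !=set0 by exists (f b), b => //; split => //=.
  have Slb : has_lbound S.
    by exists 0 => _ [t [Dt _] <-]; case/andP: (fB t Dt).
  exists (inf S) => e e0.
  have [_ [t [Dt bt] <-] te] := inf_adherent e0 (conj S0 Slb).
  exists t => // s Ds ts; rewrite ger0_norm; last first.
    rewrite subr_ge0; apply: ge_inf => //; exists s => //; split=> //.
    exact: le_trans ts.
  by rewrite ltrBlDl (le_lt_trans _ te)// noninc.
have nondec s t : D s -> D t -> s <= t -> f s <= f t.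
  move=> Ds Dt st; rewrite leNgt; apply/negP => ts; apply: nd.
  by exists s, t.
pose S := [set f t | t in D].
have S0 : S !=set0 by exists (f 0), 0 => //; exact: below_lmax0.
have Sub : has_ubound S.
  by exists B => _ [t Dt <-]; case/andP: (fB t Dt).
exists (sup S) => e e0.
have [_ [t Dt <-] te] := sup_adherent e0 (conj S0 Sub).
exists t => // s Ds ts; rewrite distrC ger0_norm; last first.
  by rewrite subr_ge0; apply: ub_le_sup => //; exists s.
by rewrite ltrBlDl -ltrBlDr (lt_le_trans te)// nondec.
Qed.

(** Quasiconcavity with the limit as right end: if f t < s <= f a, then [f] never exceeds f t after
    t, and the limit falls below s. *)
Lemma left_limit_quasiconcave f c : quasiconcave f -> left_limit f c ->
  forall a t s, D a -> D t -> a <= t -> s <= f a -> s <= c -> s <= f t.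
Proof.
move=> fq fc a t s Da Dt at_ sa sc; rewrite leNgt; apply/negP => ts.
have [|b Db bc] := fc (s - f t); first by rewrite subr_gt0.
have Dm := below_lmax_max Db Dt.
have : f (Num.max b t) <= f t.
  apply: (quasiconcave_after_drop fq Da Dm); last exact: lt_le_trans sa.
  by rewrite at_ le_max lexx orbT.
have /(_ _) := bc _ Dm; rewrite le_max lexx => /(_ isT).
by rewrite ltr_norml => /andP[]; lra.
Qed.

End left_limit.

Lemma expR_chord (R : realType) (th a : R) : 0 <= th <= 1 ->
  expR (th * a) <= 1 - th + th * expR a.
Proof.
move=> /andP[th0 th1]; have := convex_expR (Itv01 th0 th1) a 0.
by rewrite !convRE/= expR0 mulr0 addr0 mulr1 addrC.
Qed.

(** * Measures with finitely many atoms *)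

Section discrete_measures.
Context {R : realType}.

(** Normalizing by the total mass 1 leaves the values unchanged and supplies the probability
    structure. *)
Lemma measure_probability d (T : measurableType d) (m : {measure set T -> \bar R}) (x : T) :
  m setT = 1%E -> exists P : probability T R, forall A, P A = m A.
Proof.
move=> m1; exists (mnormalize m (dirac x : probability T R)) => A.
by rewrite /= /mnormalize m1 ifF/= ?invr1 ?mule1// eqe oner_eq0.
Qed.

Lemma ge0_integral_finite_combination (s : seq (R * R)) :
  {in s, forall a, 0 <= a.1} ->
  exists m : {measure set R -> \bar R}, forall (D : set R) (f : R -> \bar R),
    measurable D -> measurable_fun D f -> (forall x, D x -> (0 <= f x)%E) ->
    (\int[m]_(x in D) f x = \sum_(a <- s) a.1%:E * (\d_(a.2) D * f a.2))%E.
Proof.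
elim: s => [_|[w x] s IHs ws].
  by exists mzero => D f mD mf f0; rewrite big_nil integral_measure_zero.
have [m mE] : exists m : {measure set R -> \bar R}, forall (D : set R) (f : R -> \bar R),
    measurable D -> measurable_fun D f -> (forall x, D x -> (0 <= f x)%E) ->
    (\int[m]_(x in D) f x = \sum_(a <- s) a.1%:E * (\d_(a.2) D * f a.2))%E.
  by apply: IHs => a sa; apply: ws; rewrite inE sa orbT.
have w0 : 0 <= w by apply: (ws (w, x)); rewrite mem_head.
exists (measure_add (mscale (NngNum w0) (dirac x)) m) => D f mD mf f0.
rewrite ge0_integral_measure_add// ge0_integral_mscale// integral_dirac// big_cons.
by rewrite mE.
Qed.

End discrete_measures.

(** * Sub-psi distributions *)

Section sub_psi_hypotheses.
Context {R : realType}.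
Variables (psi : R -> \bar R) (lmax : \bar R).
Hypothesis psi_closed : closed_function psi.
Hypothesis psi_convex : convex_efunction psi.
Hypothesis psi_ge0 : forall t, (0 <= psi t)%E.
Hypothesis psi0 : psi 0 = 0%E.
Hypothesis lmax_gt0 : (0 < lmax)%E.
Hypothesis dom_psi :
  effective_domain psi = [set t : R | (0 <= t%:E < lmax)%E] \/
  ((lmax < +oo)%E /\
   effective_domain psi = [set t : R | (0 <= t%:E <= lmax)%E]).

Local Notation dom := (effective_domain psi).
Local Notation X := (sample_space psi).
Local Notation Lam := (param_space lmax).
Local Notation D := [set t : R | (0 <= t%:E < lmax)%E].
Local Notation F x := (fun t : R => expR (t * x - fine (psi t))).
Local Notation attained := (exists2 t, lmax = t%:E & dom t).

Lemma dom_param t : dom t -> 0 <= t /\ (t%:E <= lmax)%E.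
Proof.
case: dom_psi => [->|[_ ->]]; rewrite /= lee_fin => /andP[t0 tl]; split=> //.
exact: ltW.
Qed.

Lemma D_dom t : D t -> dom t.
Proof. by case: dom_psi => [->|[_ ->]]//= /andP[-> /ltW]. Qed.

Lemma dom0 : dom 0.
Proof. by rewrite /effective_domain/= psi0. Qed.

Lemma dom_D t : ~ attained -> dom t -> D t.
Proof.
move=> na dt; have [t0 tl] := dom_param dt; rewrite /= lee_fin t0/= lt_neqAle tl andbT.
by apply/eqP => E; apply: na; exists t.
Qed.

(** The dichotomy behind the later proofs: on the domain the explicit formula applies, at the
    missing endpoint a limit argument. *)
Lemma param_cases l : Lam l ->
  (exists2 t, dom t & l = t%:E) \/ (l = lmax /\ ~ attained).
Proof.
move=> /andP[l0]; rewrite le_eqVlt => /predU1P[->|ll].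
  have [[t lt dt]|] := pselect attained; last by right.
  by left; exists t.
have lfin : l \is a fin_num.
  by rewrite fin_numE gt_eqF ?lt_eqF ?(lt_le_trans _ l0) ?(lt_le_trans ll) ?leey.
left; exists (fine l); last by rewrite fineK.
by apply: D_dom; rewrite /= fineK// l0.
Qed.

Lemma dom_Lam t : dom t -> Lam t%:E.
Proof. by move=> /dom_param[t0 tl]; rewrite /param_space/= lee_fin t0. Qed.

Lemma psiK t : dom t -> psi t = (fine (psi t))%:E.
Proof. by move=> dt; rewrite fineK// ge0_fin_numE. Qed.

Lemma exp_funE t x : dom t -> exp_fun psi t%:E x = F x t.
Proof. by move=> dt; rewrite /exp_fun /left_extension/= ifT. Qed.

Lemma g_funE t x : dom t -> g_fun psi t%:E x = F x t - 1.
Proof. by move=> dt; rewrite /g_fun /left_extension/= ifT. Qed.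

(** * The sample space *)

Lemma conjugate_ge0 x : (0 <= conjugate psi x)%E.
Proof.
by apply: ereal_sup_ubound; exists 0 => //; rewrite psi0 mul0r sube0.
Qed.

Lemma nonpos_sample x : x <= 0 -> X x.
Proof.
move=> x0; rewrite /sample_space /effective_domain/=.
apply: le_lt_trans (ltry 0); apply: ge_ereal_sup => _ [t _ <-].
have [dt|ndt] := pselect (dom t).
  rewrite psiK// -EFinB lee_fin; have [t0 _] := dom_param dt.
  have : 0 <= fine (psi t) by rewrite fine_ge0.
  by have := mulr_ge0_le0 t0 x0; lra.
have -> : psi t = +oo%E by apply/eqP; rewrite -leye_eq leNgt; apply/negP.
by rewrite addeNy leNye.
Qed.

Lemma sample_down x y : x <= y -> X y -> X x.
Proof.
move=> xy; apply: le_lt_trans; apply: ge_ereal_sup => _ [t _ <-].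
have [dt|ndt] := pselect (dom t); last first.
  have -> : psi t = +oo%E by apply/eqP; rewrite -leye_eq leNgt; apply/negP.
  by rewrite addeNy leNye.
apply: le_trans (ereal_sup_ubound _); last by exists t.
by rewrite leeB// lee_fin ler_wpM2l//; have [] := dom_param dt.
Qed.

Lemma measurable_sample : measurable X.
Proof.
apply: is_interval_measurable => x y Xx Xy z /andP[_ zy].
exact: sample_down Xy.
Qed.

(** The exponent is one of the terms of the supremum defining the conjugate; the bound is uniform in
    t. *)
Lemma F_bound x t : X x -> dom t -> 0 <= F x t <= expR (fine (conjugate psi x)).
Proof.
move=> Xx dt; rewrite expR_ge0/= ler_expR -lee_fin fineK; last first.
  by rewrite ge0_fin_numE// conjugate_ge0.
by apply: ereal_sup_ubound; exists t => //; rewrite EFinB -psiK.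
Qed.

(** * Level sets of the exponent t x - psi t *)

Definition level x s := [set t | (psi t <= (t * x - s)%:E)%E].

Lemma levelP x s t : level x s t <-> dom t /\ s <= t * x - fine (psi t).
Proof.
split=> [st|[dt]]; last by rewrite /level/= (psiK dt) lee_fin; lra.
have dt : dom t by apply: le_lt_trans st _; exact: ltry.
by split=> //; move: st; rewrite /level/= (psiK dt) lee_fin; lra.
Qed.

(** A preimage of the epigraph under the continuous map t |-> (t, t x - s). *)
Lemma closed_level x s : closed (level x s).
Proof.
rewrite (_ : level x s = (fun t : R => (t, t * x - s)) @^-1` epigraph psi)//.
apply: preimage_closed => // t _.
have h : (fun t : R => t * x - s) u @[u --> t] --> t * x - s.
  apply: (@cvgB _ _ _ _ _ (fun t => t * x) (fun=> s)); last exact: cvg_cst.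
  by apply: (@cvgM _ _ _ _ id (fun=> x)); [exact: cvg_id | exact: cvg_cst].
exact: (@cvg_pair _ _ _ (nbhs t) (nbhs t) (nbhs (t * x - s)) _ _ _ id _ (@cvg_id _ _) h).
Qed.

(** Subtracting an affine function keeps [psi] convex; [th] is the weight of a in b = th a + (1 -
    th) c. *)
Lemma level_interval x s : is_interval (level x s).
Proof.
move=> a c la lc b /andP[ab bc].
have [ca|ac] := leP c a.
  by rewrite (_ : b = a)//; apply/le_anti; rewrite ab (le_trans bc).
pose th := (c - b) / (c - a).
have th0 : 0 <= th by rewrite divr_ge0// subr_ge0// ltW.
have th1 : 0 <= 1 - th by rewrite subr_ge0 ler_pdivrMr ?subr_gt0// mul1r lerD2l lerN2.
have bE : b = th * a + (1 - th) * c by rewrite /th; field; lra.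
rewrite /level/= bE; apply: le_trans (psi_convex _ _ _) _.
  by rewrite th0 -subr_ge0.
apply: (@le_trans _ _ (th%:E * (a * x - s)%:E + (1 - th)%:E * (c * x - s)%:E)%E).
  by apply: leeD; apply: lee_wpmul2l.
by rewrite -!EFinM -EFinD lee_fin; lra.
Qed.

Lemma F_quasiconcave x : quasiconcave lmax (F x).
Proof.
move=> a b c /D_dom da /D_dom dc /andP[ab bc] s sa sc.
have [s0|s0] := leP s 0; first by rewrite (le_trans s0)// expR_ge0.
rewrite -(lnK s0) ler_expR.
suff /levelP[] : level x (ln s) b by [].
apply: (@level_interval _ _ a c); rewrite ?ab//.
  by apply/levelP; split=> //; rewrite -ler_expR lnK.
by apply/levelP; split=> //; rewrite -ler_expR lnK.
Qed.

Lemma lmax_test : ~ attained ->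
  (lmax \is a fin_num) && (psi (fine lmax) < +oo)%E = false.
Proof.
move=> na; apply/negbTE/negP => /andP[lf dl]; apply: na.
by exists (fine lmax) => //; rewrite fineK.
Qed.

(** Boundedness and quasiconcavity make the limit exist, so [lim] is a genuine limit here and not a
    default value. *)
Lemma exp_fun_left x : ~ attained -> X x -> left_limit lmax (F x) (exp_fun psi lmax x).
Proof.
move=> na Xx; have FB t : D t -> 0 <= F x t <= expR (fine (conjugate psi x)).
  by move=> /D_dom; exact: F_bound.
have [c cF] := exists_left_limit lmax_gt0 FB (@F_quasiconcave x).
by rewrite /exp_fun /left_extension lmax_test// (left_limit_lim lmax_gt0 cF).
Qed.

Lemma g_fun_exp_fun l x : Lam l -> X x -> g_fun psi l x = exp_fun psi l x - 1.
Proof.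
move=> Ll Xx; have [[t dt ->]|[-> na]] := param_cases Ll.
  by rewrite g_funE// exp_funE.
rewrite /g_fun /left_extension lmax_test//.
have := left_limitB1 (exp_fun_left na Xx).
exact: left_limit_lim.
Qed.

Lemma exp_fun_bound l x : Lam l -> X x ->
  0 <= exp_fun psi l x <= expR (fine (conjugate psi x)).
Proof.
move=> Ll Xx; have [[t dt ->]|[-> na]] := param_cases Ll.
  by rewrite exp_funE//; exact: F_bound.
apply: (left_limit_bounds _ (exp_fun_left na Xx)) => t /D_dom.
exact: F_bound.
Qed.

Lemma exp_fun0 x : exp_fun psi 0%E x = 1.
Proof. by rewrite (exp_funE _ dom0) psi0 mul0r subr0 expR0. Qed.

(** The real points of the domain at this level form the closed interval [S]. If [top] holds, the
    missing endpoint joins them, and for nonempty [S] quasiconcavity up to the limit fills in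
    everything from inf S to [lmax]. *)
Lemma exp_fun_superlevel x s : X x -> 0 < s -> exists a b,
  Lam `&` [set l | s <= exp_fun psi l x] = [set l | (a <= l <= b)%E].
Proof.
move=> Xx s0; set S := level x (ln s).
have SP t : S t <-> dom t /\ s <= F x t.
  rewrite /S levelP; split=> -[dt h]; split=> //.
    by rewrite -[leLHS]lnK// ler_expR.
  by rewrite -ler_expR lnK.
pose top := ~ attained /\ s <= exp_fun psi lmax x.
have inS l : (Lam `&` [set l | s <= exp_fun psi l x]) l <->
    (exists2 t, S t & l = t%:E) \/ (l = lmax /\ top).
  split=> [[Ll sl]|[[t /SP[dt st] ->]|[-> [na sl]]]].
  - have [[t dt lt]|[lE na]] := param_cases Ll; last first.
      by right; split=> //; split=> //; rewrite -lE.
    by left; exists t => //; apply/SP; split=> //; move: sl; rewrite /= lt exp_funE.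
  - by split; [exact: dom_Lam | rewrite /= exp_funE].
  - by split=> //; rewrite /param_space/= lexx ltW.
have [[t0 St0]|S0] := pselect (exists t, S t); last first.
  have [tp|ntp] := pselect top.
    exists lmax, lmax; apply/seteqP; split=> l.
      by move=> /inS[[t St _]|[-> _]]; [case: S0; exists t | rewrite /= lexx].
    by move=> /= /le_anti lE; apply/inS; right.
  exists 1%E, 0%E; apply/seteqP; split=> l.
    by move=> /inS[[t St _]|[_ //]]; case: S0; exists t.
  by move=> /= /andP[l1 l0]; have := le_trans l1 l0; rewrite lee_fin ler10.
have Slb : has_lbound S by exists 0 => t /SP[/dom_param[]].
have SI : S (inf S) by apply: closed_inf => //; [exists t0 | exact: closed_level].
have infS t : S t -> inf S <= t by move=> St; exact: ge_inf.
have [tp|ntp] := pselect top.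
  exists (inf S)%:E, lmax; apply/seteqP; split=> l.
    move=> /inS[[t St ->]|[-> _]]/=.
      by rewrite lee_fin infS//=; have /SP[/dom_param[]] := St.
    by rewrite lexx andbT; have /SP[/dom_param[]] := SI.
  move=> /= /andP[al lb]; have [na sl] := tp; apply/inS.
  have Ll : Lam l.
    rewrite /param_space/= lb andbT; apply: le_trans al; rewrite lee_fin.
    by have /SP[/dom_param[]] := SI.
  have [[t dt lt]|[-> _]] := param_cases Ll; [left; exists t => //|by right].
  have /SP[di si] := SI; apply/SP; split=> //.
  apply: (left_limit_quasiconcave (@F_quasiconcave x) (exp_fun_left na Xx) (a := inf S)) => //.
  - exact: dom_D.
  - exact: dom_D.
  - by rewrite -lee_fin -lt.
have Sub : has_ubound S.
  have [[t lt dt]|na] := pselect attained.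
    by exists t => u /SP[/dom_param[_ ]]; rewrite lt lee_fin.
  (* The limit is strictly below s, so F x stays below s beyond some a, which bounds [S]. *)
  have [|a Da ac] := exp_fun_left na Xx (_ : 0 < s - exp_fun psi lmax x).
    by rewrite subr_gt0 ltNge; apply/negP => sl; apply: ntp.
  exists a => u /SP[/(dom_D na) Du su]; rewrite leNgt; apply/negP => au.
  by have := ac u Du (ltW au); rewrite ltr_norml => /andP[]; lra.
have SS : S (sup S) by apply: closed_sup => //; [exists t0 | exact: closed_level].
exists (inf S)%:E, (sup S)%:E; apply/seteqP; split=> l.
  move=> /inS[[t St ->]|[_ //]]/=.
  by rewrite !lee_fin infS//=; exact: ub_le_sup.
case: l => [t| |]/=; rewrite ?leye_eq ?andbF// !lee_fin => ab.
apply/inS; left; exists t => //.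
exact: (level_interval SI SS).
Qed.

Lemma measurable_F t : measurable_fun setT (fun x : R => F x t).
Proof.
by apply: measurableT_comp => //; apply: measurable_funB.
Qed.

Lemma measurable_exp_fun l : Lam l -> measurable_fun X (exp_fun psi l).
Proof.
move=> Ll; have mX := measurable_sample.
have [[t dt ->]|[-> na]] := param_cases Ll.
  rewrite (_ : exp_fun psi t%:E = fun y => F y t).
    exact: measurable_funTS (measurable_F t).
  by apply/funext => y; rewrite exp_funE.
apply: (measurable_fun_cvg (h := fun n y => F y (left_seq lmax n))).
  by move=> n; exact: measurable_funTS (measurable_F _).
move=> y Xy; apply: (left_seq_cvg lmax_gt0 (f := F y)).
exact: exp_fun_left.
Qed.

(** * Integrals of e-values and of their mixtures *)

Section integrals.
Variable mu : probability R R.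
Hypothesis muP : sub_psi_hypothesis psi mu.

Lemma integral_F_le1 t : dom t -> (\int[mu]_x (F x t)%:E <= 1)%E.
Proof.
move=> dt; have [/(_ _ dt) mut _] := muP.
rewrite (eq_integral (fun x => (expR (- fine (psi t)))%:E * (expR (t * x))%:E)%E); last first.
  by move=> x _; rewrite -EFinM -expRD addrC.
rewrite ge0_integralZl_EFin//; last first.
  by apply/measurable_EFinP; apply: measurableT_comp => //; exact: measurable_funM.
apply: le_trans (lee_wpmul2l _ mut) _; first by rewrite lee_fin expR_ge0.
by rewrite (psiK dt)/= -EFinM -expRD addNr expR0.
Qed.

(** On the domain this is the sub-psi inequality; at the missing endpoint Fatou's lemma applies
    along [left_seq]. *)
Lemma integral_exp_fun_le1 l : Lam l ->
  (\int[mu]_(x in X) (exp_fun psi l x)%:E <= 1)%E.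
Proof.
move=> Ll; have mX := measurable_sample.
have FX t : dom t -> (\int[mu]_(x in X) (F x t)%:E <= 1)%E.
  move=> dt; apply: le_trans (integral_F_le1 dt).
  apply: ge0_subset_integral => //.
  by apply/measurable_EFinP; exact: measurable_F.
have [[t dt ->]|[-> na]] := param_cases Ll.
  by under eq_integral do rewrite exp_funE//; exact: FX.
pose f n y := (F y (left_seq lmax n))%:E.
rewrite (eq_integral (fun x => limn_einf (f^~ x))); last first.
  move=> x; rewrite inE => Xx; apply/esym.
  apply: (cvg_limn_einf_sup _).1.
  apply: cvg_EFin; first exact: nearW.
  apply: (left_seq_cvg lmax_gt0 (f := F x)).
  exact: exp_fun_left.
apply: le_trans (fatou _ _ _ _) _ => //.
- by move=> n; apply/measurable_EFinP; exact: measurable_funTS (measurable_F _).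
- by move=> n x _; rewrite lee_fin expR_ge0.
rewrite limn_einf_lim; apply: lime_le; first exact: is_cvg_einfs.
apply: nearW => n; apply: (@le_trans _ _ (\int[mu]_(x in X) f n x)%E).
  by apply: ereal_inf_lbound; exists n => /=.
by apply: FX; apply: (D_dom); exact: left_seqD.
Qed.

Variable nu : {finite_measure set (\bar R) -> \bar R}.

(* A version of [exp_fun] that is jointly measurable on the whole product, and
   0 off [Lam]; the missing endpoint is treated apart. *)
Let A := [set l : \bar R | l = lmax /\ ~ attained].
Let a := (fun l => exp_fun psi l 0) \_ (Lam `\` A).
Let b := exp_fun psi lmax \_ X.
Let K (p : \bar R * R) : \bar R :=
  (a p.1 * expR (fine p.1 * p.2) + \1_A p.1 * b p.2)%:E.

Let mLam : measurable Lam.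
Proof. exact: (emeasurable_itv `[0%E, lmax]). Qed.

Let mA : measurable A.
Proof.
have [at_|na] := pselect attained.
  by rewrite (_ : A = set0)//; apply/seteqP; split=> l // [].
rewrite (_ : A = [set` `[lmax, lmax]]); first exact: emeasurable_itv.
apply/seteqP; split=> l /=; first by move=> [-> _]; rewrite in_itv/= lexx.
by rewrite in_itv/= => /le_anti <-; split.
Qed.

Let lmaxLam : Lam lmax.
Proof. by rewrite /param_space/= lexx ltW. Qed.

(** On the domain the e-value is exp (- psi l), which is [exp_fun] at x = 0 and measurable by its
    superlevel intervals, times exp (l x); at the missing endpoint only x varies. *)
Let measurable_K : measurable_fun setT K.
Proof.
apply/measurable_EFinP; apply: measurable_funD; apply: measurable_funM.
- have ma : measurable_fun setT a.
    apply: (measurable_restrictT _ _).1; first exact: measurableD mLam mA.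
    apply: (@measurable_funS _ _ _ _ Lam _ _ mLam (@subDsetl _ _ _)).
    have X0 : X 0 by exact: (nonpos_sample (lexx 0)).
    apply: measurable_superlevel => //.
      by move=> l Ll; have /andP[] := exp_fun_bound Ll X0.
    by move=> s s0; apply: exp_fun_superlevel.
  exact: measurableT_comp ma measurable_fst.
- apply: measurableT_comp => //; apply: measurable_funM => //.
  exact: (measurableT_comp (fine_measurable measurableT)).
- have mi : measurable_fun setT (\1_A : \bar R -> R) by exact: measurable_indic.
  exact: (measurableT_comp mi measurable_fst).
- have mb : measurable_fun setT b.
    apply: (measurable_restrictT _ _).1; first exact: (measurable_sample).
    exact: measurable_exp_fun.
  exact: measurableT_comp mb measurable_snd.
Qed.

Let exp_fun_ge0 l x : Lam l -> X x -> 0 <= exp_fun psi l x.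
Proof. by move=> Ll Xx; have /andP[] := exp_fun_bound Ll Xx. Qed.

Let K_dom t x : dom t -> K (t%:E, x) = (F x t)%:E.
Proof.
move=> dt; have nA : ~ A t%:E by move=> [tl]; apply; exists t.
rewrite /K/= /a patchE ifT; last first.
  by apply/mem_set; split=> //; exact: (dom_Lam).
rewrite indicE memNset// mul0r addr0 exp_funE// mulr0 add0r -expRD.
by rewrite addrC.
Qed.

Let K_lmax x : ~ attained -> K (lmax, x) = (b x)%:E.
Proof.
move=> na; rewrite /K/= /a patchE memNset; last by move=> [_]; apply.
by rewrite mul0r add0r indicE mem_set// mul1r.
Qed.

Let K_off l x : ~ Lam l -> K (l, x) = 0%E.
Proof.
move=> nl; rewrite /K/= /a patchE memNset; last by move=> [].
by rewrite mul0r add0r indicE memNset ?mul0r// => -[lE]; move: nl; rewrite lE.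
Qed.

Let K_exp_fun l x : Lam l -> X x -> K (l, x) = (exp_fun psi l x)%:E.
Proof.
move=> Ll Xx; have [[t dt ->]|[-> na]] := param_cases Ll.
  by rewrite K_dom// exp_funE.
by rewrite K_lmax// /b patchE mem_set.
Qed.

Let K_ge0 p : (0 <= K p)%E.
Proof.
case: p => l x; have [Ll|nl] := pselect (Lam l); last by rewrite K_off.
have [[t dt ->]|[-> na]] := param_cases Ll.
  by rewrite K_dom// lee_fin expR_ge0.
rewrite K_lmax// /b patchE lee_fin; case: ifPn => // /set_mem Xx.
exact: exp_fun_ge0.
Qed.

Let mixture x : X x ->
  (\int[nu]_(l in Lam) (exp_fun psi l x)%:E = \int[nu]_l K (l, x))%E.
Proof.
move=> Xx; rewrite integral_mkcond; apply: eq_integral => l _.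
rewrite patchE; case: ifPn => [/set_mem Ll|/negP nl]; first by rewrite K_exp_fun.
by rewrite K_off// => Ll; apply: nl; exact: mem_set.
Qed.

Lemma measurable_mixture :
  measurable_fun X (fun x => \int[nu]_(l in Lam) (exp_fun psi l x)%:E)%E.
Proof.
apply: (eq_measurable_fun (fun x => \int[nu]_l K (l, x))%E).
  by move=> x /set_mem Xx; rewrite mixture.
apply: measurable_funTS; exact: (@measurable_fun_fubini_tonelli_G _ _ _ _ _ nu K measurable_K K_ge0).
Qed.

(** By Tonelli's theorem x may be integrated first, which gives at most 1 for l in [Lam] and 0 off
    it. *)
Lemma integral_mixture_le :
  (\int[mu]_(x in X) \int[nu]_(l in Lam) (exp_fun psi l x)%:E <= nu Lam)%E.
Proof.
have mX := measurable_sample.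
rewrite (eq_integral (fun x => \int[nu]_l K (l, x))%E); last first.
  by move=> x /set_mem Xx; rewrite mixture.
apply: (@le_trans _ _ (\int[mu]_x \int[nu]_l K (l, x))%E).
  apply: ge0_subset_integral => //.
    exact: (@measurable_fun_fubini_tonelli_G _ _ _ _ _ nu K measurable_K K_ge0).
  by move=> x _; exact: integral_ge0.
rewrite -(@fubini_tonelli _ _ _ _ _ nu mu K measurable_K K_ge0).
rewrite -[leRHS]mul1e -[1%E]/(1%:E) -integral_cst// [leRHS]integral_mkcond.
apply: ge0_le_integral => //.
- by move=> l _; exact: integral_ge0.
- exact: (@measurable_fun_fubini_tonelli_F _ _ _ _ _ mu K measurable_K K_ge0).
- exact: ((measurable_restrictT (cst 1%E) mLam).1 (measurable_cst _)).
move=> l _; rewrite patchE; case: ifPn => [/set_mem Ll|/negP nl]; last first.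
  rewrite integral0_eq// => x _; rewrite K_off// => Ll; apply: nl; exact: mem_set.
have [[t dt lE]|[lE na]] := param_cases Ll.
  rewrite lE; under eq_integral do rewrite K_dom//.
  exact: integral_F_le1.
rewrite lE; under eq_integral do rewrite K_lmax//.
apply: le_trans (integral_exp_fun_le1 lmaxLam).
rewrite [leRHS]integral_mkcond le_eqVlt; apply/orP; left; apply/eqP.
by apply: eq_integral => x _; rewrite /b !patchE; case: ifP.
Qed.

End integrals.

(** * Atomic distributions in the hypothesis *)

Lemma finite_combination_hypothesis (s : seq (R * R)) :
  {in s, forall a, 0 <= a.1 /\ X a.2} -> \sum_(a <- s) a.1 = 1 ->
  (forall t, dom t -> \sum_(a <- s) a.1 * F a.2 t <= 1) ->
  exists2 mu, sub_psi_hypothesis psi mu & forall h : R -> R, measurable_fun X h ->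
    (\int[mu]_(x in X) (h x)%:E = (\sum_(a <- s) a.1 * h a.2)%:E)%E.
Proof.
move=> gs s1 sF.
have mX := measurable_sample.
have [m mE] := ge0_integral_finite_combination (fun a sa => (gs a sa).1).
(* Used for the whole line and for the sample space; both contain every atom. *)
have mint (D : set R) (f : R -> R) : measurable D -> X `<=` D -> measurable_fun D f ->
    (forall x, D x -> 0 <= f x) ->
    (\int[m]_(x in D) (f x)%:E = (\sum_(a <- s) a.1 * f a.2)%:E)%E.
  move=> mD XD mf f0; rewrite mE//; last exact/measurable_EFinP.
  rewrite -sumEFin !big_seq; apply: eq_bigr => a sa.
  by rewrite diracE mem_set ?mul1e//; apply: XD; exact: (gs a sa).2.
have mass D : measurable D -> X `<=` D -> m D = 1%E.
  move=> mD XD; rewrite -[LHS]mul1e -[1%E]/(1%:E) -integral_cst// mint//.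
  by under eq_bigr do rewrite mulr1; rewrite s1.
have [mu mum] := measure_probability (0 : R) (mass setT measurableT (@subsetT _ _)).
have {mum}mum : (mu : set R -> \bar R) = m by apply/funext.
exists mu.
  split; last by rewrite mum mass.
  move=> t dt; rewrite mum mint//; first last.
    by apply: measurableT_comp => //; exact: measurable_funM.
  rewrite (psiK dt) lee_fin.
  rewrite -[leRHS]mulr1 -ler_pdivrMl ?expR_gt0// -expRN mulr_sumr.
  apply: le_trans (sF t dt); rewrite le_eqVlt; apply/orP; left; apply/eqP.
  by apply: eq_bigr => a _; rewrite mulrCA -expRD addrC.
move=> h mh; rewrite mum integralE.
have hp x : ((EFin \o h)^\+ x = (Num.max (h x) 0)%:E)%E by rewrite funeposE EFin_max.
have hn x : ((EFin \o h)^\- x = (Num.max (- h x) 0)%:E)%E.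
  by rewrite funenegE EFin_max.
rewrite (eq_integral _ _ (fun x _ => hp x)) (eq_integral _ _ (fun x _ => hn x)).
rewrite !mint//.
- rewrite -EFinB -sumrB; congr EFin; apply: eq_bigr => a _.
  rewrite -mulrBr; congr (_ * _).
  by case: (leP 0 (h a.2)) => h0; case: (leP 0 (- h a.2)); lra.
- by apply: measurable_maxr => //; exact: measurable_funN.
- by move=> x _; rewrite le_max lexx orbT.
- exact: measurable_maxr.
- by move=> x _; rewrite le_max lexx orbT.
Qed.

Lemma seq_upper_bound (s : seq (R * R)) :
  exists2 B, 1 <= B & {in s, forall a, a.2 <= B}.
Proof.
elim: s => [|a s [B B1 sB]]; first by exists 1.
exists (Num.max a.2 B) => [|b]; first by rewrite le_max B1 orbT.
rewrite inE => /predU1P[->|/sB bB]; first by rewrite le_max lexx.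
by rewrite le_max bB orbT.
Qed.

Lemma F_le_exp x t : F x t <= expR (t * x).
Proof. by rewrite ler_expR gerBl fine_ge0. Qed.

(* Shrinking the weights by 1 - eps leaves room for the missing mass at a point
   -M far to the left, where every e-value is nonnegative. The constraint at t
   survives because of the slack eps if t >= d, and by convexity of exp between
   the endpoints 0 and d otherwise. *)
Lemma combination_shrunk_le (h : R -> R) (s : seq (R * R)) (eps : R) :
  measurable_fun X h -> (forall x, x <= 0 -> 0 <= h x) ->
  (forall mu, sub_psi_hypothesis psi mu -> (\int[mu]_(x in X) (h x)%:E <= 1)%E) ->
  {in s, forall a, 0 <= a.1 /\ X a.2} ->
  (forall l, Lam l -> \sum_(a <- s) a.1 * exp_fun psi l a.2 <= 1) ->
  0 < eps < 1 -> (1 - eps) * \sum_(a <- s) a.1 * h a.2 <= 1.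
Proof.
move=> mh h0 hP gs sE /andP[e0 e1].
have w0 a : a \in s -> 0 <= a.1 by move=> /gs[].
have sF t : dom t -> \sum_(a <- s) a.1 * F a.2 t <= 1.
  move=> dt; apply: le_trans (sE _ (dom_Lam dt)).
  rewrite le_eqVlt; apply/orP; left; apply/eqP; apply: eq_bigr => a _.
  by rewrite exp_funE.
set sigma := \sum_(a <- s) a.1.
have sigma0 : 0 <= sigma.
  by rewrite /sigma big_seq; apply: sumr_ge0 => a /w0.
have sigma1 : sigma <= 1.
  apply: le_trans (sF 0 (dom0)); rewrite le_eqVlt; apply/orP; left; apply/eqP.
  by apply: eq_bigr => a _; rewrite psi0 mul0r subr0 expR0 mulr1.
have [B B1 sB] := seq_upper_bound s.
have B0 : 0 < B by apply: lt_le_trans B1.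
(* For t <= d the exponential at each atom of [s] is at most 1 + eps; for t >= d the one at - M is
   at most eps^2. *)
pose d := ln (1 + eps) / B; pose M := - ln (eps ^+ 2) / d.
have d0 : 0 < d by rewrite divr_gt0// ln_gt0 // ltrDl.
have edB : expR (d * B) = 1 + eps.
  by rewrite /d divfK ?gt_eqF// lnK// posrE; lra.
have edM : expR (d * - M) = eps ^+ 2.
  rewrite /M mulNr opprK mulrC divfK ?gt_eqF// lnK// posrE.
  exact: exprn_gt0.
have M0 : 0 <= M.
  apply: divr_ge0 (ltW d0); rewrite oppr_ge0 ln_le0// expr_le1// ltW//.
pose y := (1 - eps) * sigma.
have y0 : 0 <= y by rewrite mulr_ge0// subr_ge0 ltW.
have y1 : y <= 1 - eps by rewrite ger_pMr// subr_gt0.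
pose s' := (1 - y, - M) :: [seq ((1 - eps) * a.1, a.2) | a <- s].
have [|||mu muP muE] := @finite_combination_hypothesis s'.
- move=> b; rewrite inE => /predU1P[->|/mapP[a /gs[a0 Xa] ->]]/=.
    split; first lra.
    by apply: (nonpos_sample); rewrite oppr_le0.
  by split=> //; rewrite mulr_ge0// subr_ge0 ltW.
- by rewrite big_cons big_map/= -mulr_sumr -/sigma -/y subrK.
- move=> t dt; rewrite big_cons big_map/=.
  have [t0 _] := dom_param dt.
  under eq_bigr do rewrite -mulrA; rewrite -mulr_sumr.
  have FM : F (- M) t <= expR (t * - M) by exact: F_le_exp.
  (* For t >= d the atom at - M costs at most eps^2 <= eps, which the factor 1 - eps pays for. *)
  have [dt'|td] := leP d t.
    have FM' : F (- M) t <= eps ^+ 2.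
      apply: le_trans FM _; rewrite -edM ler_expR !mulrN lerN2.
      by rewrite ler_wpM2r.
    have := sF t dt; have := expR_ge0 (t * - M - fine (psi t)).
    set S := \sum_(a <- s) _; set f := expR _ in FM' * => f0 S1.
    have : (1 - eps) * S <= 1 - eps by rewrite ger_pMr// subr_gt0.
    have : (1 - y) * f <= eps ^+ 2.
      by apply: le_trans FM'; apply: ler_piMl => //; lra.
    have : eps ^+ 2 <= eps by rewrite expr2 ger_pMr// ltW.
    lra.
  pose th := t / d.
  have th01 : 0 <= th <= 1 by rewrite divr_ge0 ?(ltW d0)//= ler_pdivrMr// mul1r ltW.
  have tE z : t * z = th * (d * z) by rewrite mulrA /th divfK// gt_eqF.
  have FM' : F (- M) t <= 1 - th + th * eps ^+ 2.
    by apply: le_trans FM _; rewrite tE -edM; exact: expR_chord.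
  have S1 : \sum_(a <- s) a.1 * F a.2 t <= sigma * (1 + th * eps).
    rewrite /sigma mulr_suml big_seq [leRHS]big_seq; apply: ler_sum => a sa.
    apply: ler_wpM2l; first exact: w0.
    apply: le_trans (F_le_exp _ _) _.
    apply: (@le_trans _ _ (expR (t * B))); first by rewrite ler_expR ler_wpM2l// sB.
    rewrite tE; apply: le_trans (expR_chord _ th01) _; rewrite edB; lra.
  apply: (@le_trans _ _ ((1 - y) * (1 - th + th * eps ^+ 2) +
      (1 - eps) * (sigma * (1 + th * eps)))).
    by apply: lerD; apply: ler_wpM2l => //; lra.
  have /andP[th0 _] := th01.
  have -> : (1 - y) * (1 - th + th * eps ^+ 2) +
        (1 - eps) * (sigma * (1 + th * eps)) =
      1 - th * ((1 - y) * (1 - eps ^+ 2) - y * eps) by rewrite /y; ring.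
  rewrite gerBl; apply: mulr_ge0 => //.
  (* The factor to be bounded below is the sum of this quantity and the next; the sign of this one
     comes from y <= 1 - eps. *)
  have : 0 <= (1 - eps - y) * (1 - eps ^+ 2 + eps).
    apply: mulr_ge0; first lra.
    by have : eps ^+ 2 <= eps; [rewrite expr2 ger_pMr// ltW | lra].
  have : 0 <= eps ^+ 2 * (1 - eps) by rewrite mulr_ge0 ?sqr_ge0// subr_ge0 ltW.
  lra.
have := hP mu muP; rewrite muE// lee_fin big_cons big_map/=.
under eq_bigr do rewrite -mulrA; rewrite -mulr_sumr => H.
apply: le_trans H; rewrite lerDr mulr_ge0//; first lra.
by apply: h0; rewrite oppr_le0.
Qed.

(** Scaling the weights by 1 / (c + e) reduces to the bound 1; a suitable eps then removes the
    factor 1 - eps, and e is arbitrary. *)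
Lemma combination_le (h : R -> R) (s : seq (R * R)) (c : R) :
  measurable_fun X h -> (forall x, x <= 0 -> 0 <= h x) ->
  (forall mu, sub_psi_hypothesis psi mu -> (\int[mu]_(x in X) (h x)%:E <= 1)%E) ->
  {in s, forall a, 0 <= a.1 /\ X a.2} ->
  (forall l, Lam l -> \sum_(a <- s) a.1 * exp_fun psi l a.2 <= c) ->
  \sum_(a <- s) a.1 * h a.2 <= c.
Proof.
move=> mh h0 hP gs sE; apply/ler_addgt0Pr => e e0.
(* At l = 0 every e-value is 1, so c bounds the sum of the weights. *)
have c0 : 0 <= c.
  apply: le_trans (sE 0%E _); last exact: (dom_Lam (dom0)).
  rewrite big_seq; apply: sumr_ge0 => a /gs[a0 Xa].
  by rewrite (exp_fun0) mulr1.
have ce0 : 0 < c + e by lra.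
have k0 : 0 < (c + e)^-1 by rewrite invr_gt0.
pose s' := [seq ((c + e)^-1 * a.1, a.2) | a <- s].
have sum' (g : R -> R) : \sum_(a <- s') a.1 * g a.2 = (c + e)^-1 * \sum_(a <- s) a.1 * g a.2.
  by rewrite big_map mulr_sumr; apply: eq_bigr => a _ /=; rewrite mulrA.
have gs' : {in s', forall a, 0 <= a.1 /\ X a.2}.
  move=> _ /mapP[a /gs[a0 Xa] ->]; split=> //.
  by apply: mulr_ge0 => //; exact: ltW.
have sE' l : Lam l -> \sum_(a <- s') a.1 * exp_fun psi l a.2 <= 1.
  move=> Ll; rewrite sum' ler_pdivrMl// mulr1; apply: le_trans (sE l Ll) _; lra.
rewrite -[leRHS]mulr1 -ler_pdivrMl// -sum'.
set S := \sum_(a <- s') _; rewrite leNgt; apply/negP => S1.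
have S0 : 0 < S by lra.
(* This choice turns (1 - eps) S into (S + 1) / 2, which still exceeds 1. *)
pose eps := (S - 1) / (2 * S).
have eps01 : 0 < eps < 1.
  by apply/andP; split; [apply: divr_gt0; lra | rewrite ltr_pdivrMr; lra].
have := combination_shrunk_le mh h0 hP gs' sE' eps01.
rewrite -/S; have -> : (1 - eps) * S = (S + 1) / 2 by rewrite /eps; field; lra.
lra.
Qed.

(** Otherwise there are points x n <= 0 with |f (x n)| >= 2^(n+1); giving them the masses 2^-(n+1)
    yields a member of the hypothesis under which |f| has infinite integral. *)
Lemma heavy_tail (f : R -> R) : L_Phi psi f ->
  exists2 C, 0 < C & forall x, x <= 0 -> - C <= f x.
Proof.
move=> [mf fP]; apply: contrapT => nC.
have xP n : exists x : R, x <= 0 /\ 2 ^+ n.+1 <= `|f x|.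
  apply: contrapT => nx; apply: nC; exists (2 ^+ n.+1); first exact: exprn_gt0.
  move=> x x0; rewrite leNgt; apply/negP => fx; apply: nx; exists x; split=> //.
  have p0 : (0 : R) < 2 ^+ n.+1 by exact: exprn_gt0.
  by rewrite ler0_norm; lra.
have [x xprop] := choice xP.
have w0 n : 0 <= ((2 ^ n.+1)%:R^-1 : R) by rewrite invr_ge0.
pose w n := NngNum (w0 n).
pose m : {measure set R -> \bar R} :=
  mseries (fun n => mscale (w n) (dirac (x n))) 0.
have mX := measurable_sample.
have xX n : X (x n) by apply: (nonpos_sample); have [] := xprop n.
have mE (D : set R) (g : R -> R) : measurable D -> X `<=` D -> measurable_fun D g ->
    (forall x, D x -> 0 <= g x) ->
    (\int[m]_(x in D) (g x)%:E = \sum_(0 <= n <oo) ((w n)%:num * g (x n))%:E)%E.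
  move=> mD XD mg g0; have mEg : measurable_fun D (EFin \o g) by exact/measurable_EFinP.
  rewrite ge0_integral_measure_series//; apply: eq_eseriesr => n _.
  rewrite ge0_integral_mscale//= integral_dirac// diracE mem_set ?mul1e//.
  exact: XD.
have w1 : (\sum_(0 <= n <oo) ((w n)%:num)%:E = 1 :> \bar R)%E.
  apply/cvg_lim => //; have := @cvg_geometric_eseries_half R 1 0.
  rewrite expr0 divr1; apply: cvg_trans; apply: near_eq_cvg; apply: nearW => n.
  by apply: eq_bigr => k _; rewrite /w/= addn1 div1r.
have mass (D : set R) : measurable D -> X `<=` D -> m D = 1%E.
  move=> mD XD; rewrite -[LHS]mul1e -[1%E]/(1%:E) -integral_cst// mE//.
  by rewrite -w1; apply: eq_eseriesr => n _; rewrite mulr1.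
have [mu mum] := measure_probability (0 : R) (mass setT measurableT (@subsetT _ _)).
have {mum}mum : (mu : set R -> \bar R) = m by apply/funext.
have muP : sub_psi_hypothesis psi mu.
  split; last by rewrite mum mass.
  move=> t dt; rewrite mum mE//; last first.
    by apply: measurableT_comp => //; exact: measurable_funM.
  (* For t >= 0 >= x one has exp (t x) <= 1 <= exp (psi t), whatever the weights. *)
  apply: (@le_trans _ _ 1%E); last first.
    by rewrite (psiK dt) lee_fin -expR0 ler_expR fine_ge0.
  rewrite -w1; apply: lee_nneseries => n _; rewrite lee_fin.
    by move=> _; apply: mulr_ge0; [exact: w0 | exact: expR_ge0].
  apply: ler_piMr; [exact: w0 | rewrite -expR0 ler_expR].
  by apply: mulr_ge0_le0; [case: (dom_param dt) | case: (xprop n)].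
have := fP mu muP; rewrite mum mE//; last exact: measurableT_comp.
set S := limn _ => Soo.
have term n : 1 <= (w n)%:num * `|f (x n)|.
  by rewrite /w/= ler_pdivlMl ?ltr0n ?expn_gt0// mulr1 natrX; case: (xprop n).
have Sge N : (N%:R%:E <= S)%E.
  apply: le_trans (nneseries_lim_ge N _) => [|n _ _]; last first.
    by rewrite lee_fin (le_trans _ (term n)).
  rewrite sumEFin lee_fin big_mkord -[leLHS]mulr_natl mulr1.
  have -> : N%:R = \sum_(n < N) 1 :> R by rewrite sumr_const card_ord.
  by apply: ler_sum => n _.
have Sfin : S \is a fin_num by rewrite ge0_fin_numE// (le_trans _ (Sge 0)).
have := Sge (Num.bound (fine S)); rewrite -(fineK Sfin) lee_fin leNgt => /negP; apply.
by apply: archi_boundP; rewrite fine_ge0// (le_trans _ (Sge 0)).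
Qed.

Lemma dominating_mixture_sub_psi (h : R -> R) :
  measurable_fun X h -> (forall x, x <= 0 -> 0 <= h x) ->
  (forall mu, sub_psi_hypothesis psi mu -> (\int[mu]_(x in X) (h x)%:E <= 1)%E) ->
  exists2 nu : probability (\bar R) R, nu (~` Lam) = 0%E &
    forall x, X x -> ((h x)%:E <= \int[nu]_(l in Lam) (exp_fun psi l x)%:E)%E.
Proof.
move=> mh h0 hP; apply: (dominating_mixture (ltW lmax_gt0)).
- move=> x Xx; exists (expR (fine (conjugate psi x))) => l Ll.
  exact: (exp_fun_bound).
- move=> x Xx s s0.
  exact: (exp_fun_superlevel).
- by move=> s c gs sE; apply: (combination_le mh h0 hP gs).
Qed.

(** Let K = exp (psi* x), which bounds all e-values at x. For the truncation of [h] at K + 1,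
    [combination_le] with a single atom at x gives a value at most K, so h x = +oo is impossible. *)
Lemma e_variable_finite (h : R -> \bar R) x : e_variables psi h -> X x ->
  (h x < +oo)%E.
Proof.
move=> [mh h0 hP] Xx; have mX := measurable_sample.
set K := expR (fine (conjugate psi x)).
rewrite ltNge leye_eq; apply/negP => /eqP hx.
pose k y : R := fine (Order.min (h y) (K + 1)%:E).
have K0 : (0 <= (K + 1)%:E)%E by rewrite lee_fin addr_ge0// expR_ge0.
have kE y : X y -> (k y)%:E = Order.min (h y) (K + 1)%:E.
  move=> Xy; rewrite fineK// ge0_fin_numE.
    by rewrite gt_min ltry orbT.
  by rewrite le_min h0// K0.
have k0 y : X y -> 0 <= k y.
  by move=> Xy; rewrite -lee_fin kE// le_min h0// K0.
have mk : measurable_fun X k.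
  apply: (measurableT_comp (fine_measurable measurableT)).
  exact: measurable_mine.
have : k x <= K.
  have := @combination_le k [:: (1, x)] K mk.
  rewrite !big_seq1 mul1r; apply.
  - by move=> y y0; apply: k0; exact: (nonpos_sample).
  - move=> mu muP; apply: le_trans (hP mu muP); apply: ge0_le_integral => //.
    + exact/measurable_EFinP.
    + by move=> y Xy; rewrite kE// ge_min lexx.
  - by move=> a; rewrite inE => /eqP ->.
  - move=> l Ll; rewrite big_seq1 mul1r.
    by have /andP[] := exp_fun_bound Ll Xx.
rewrite -lee_fin kE// hx min_r ?leey// lee_fin; lra.
Qed.

(** * Mixtures under a finite measure *)

Section mixtures.
Variable nu : {finite_measure set (\bar R) -> \bar R}.

Let mLam : measurable Lam.
Proof. exact: (emeasurable_itv `[0%E, lmax]). Qed.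

Let nuLam : nu Lam \is a fin_num. Proof. exact: fin_num_measure. Qed.

Lemma integrable_exp_fun x : X x -> nu.-integrable Lam (fun l => (exp_fun psi l x)%:E).
Proof.
move=> Xx; have Eb l (Ll : Lam l) :=
  exp_fun_bound Ll Xx.
apply: (@measurable_bounded_integrable _ _ _ nu (fun l => exp_fun psi l x)) => //.
- by rewrite -ge0_fin_numE.
- apply: measurable_superlevel => //; first by move=> l /Eb/andP[].
  move=> s s0.
  exact: (exp_fun_superlevel).
exists (expR (fine (conjugate psi x))); split; first exact: num_real.
move=> M cM l /= /Eb /andP[E0 E1].
by rewrite ger0_norm// (le_trans E1)// ltW.
Qed.

Lemma integral_g_fun x : X x ->
  (\int[nu]_(l in Lam) (g_fun psi l x)%:E =
   \int[nu]_(l in Lam) (exp_fun psi l x)%:E - nu Lam)%E.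
Proof.
move=> Xx; rewrite (eq_integral (fun l => (exp_fun psi l x)%:E - (cst 1%:E) l)%E); last first.
  move=> l /set_mem Ll; rewrite -EFinB.
  by rewrite (g_fun_exp_fun).
rewrite integralB//; first last.
- exact: (finite_measure_integrable_cst nu).
- exact: integrable_exp_fun.
by rewrite integral_cst// mul1e.
Qed.

End mixtures.

End sub_psi_hypotheses.

(** * Functions with nonpositive integrals, and e-variables *)

Theorem theorem4p3 (R : realType) (psi : R -> \bar R) (lmax : \bar R)
    (psi_closed : closed_function psi)
    (psi_convex : convex_efunction psi)
    (psi_ge0 : forall t, (0 <= psi t)%E)
    (psi0 : psi 0 = 0%E)
    (lmax_gt0 : (0 < lmax)%E)
    (dom_psi :
      effective_domain psi = [set t : R | (0 <= t%:E < lmax)%E] \/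
      ((lmax < +oo)%E /\
       effective_domain psi = [set t : R | (0 <= t%:E <= lmax)%E])) :
  (forall f : R -> R, L_Phi psi f ->
    ((forall mu, sub_psi_hypothesis psi mu ->
        (\int[mu]_(x in sample_space psi) (f x)%:E <= 0)%E)
     <->
     exists2 nu : {finite_measure set (\bar R) -> \bar R},
       nu (~` param_space lmax) = 0%E &
       forall x, sample_space psi x ->
         ((f x)%:E <= \int[nu]_(l in param_space lmax) (g_fun psi l x)%:E)%E))
  /\
  e_variables psi =
    [set h : R -> \bar R |
      [/\ measurable_fun (sample_space psi) h,
          (forall x, sample_space psi x -> (0 <= h x)%E) &
          exists2 nu : probability (\bar R) R,
            nu (~` param_space lmax) = 0%E &
            forall x, sample_space psi x ->
              (h x <= \int[nu]_(l in param_space lmax)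
                        (exp_fun psi l x)%:E)%E]].
Proof.
have mX := measurable_sample dom_psi.
have mLam : measurable (param_space lmax) by exact: (emeasurable_itv `[0%E, lmax]).
split.
  move=> f fL; have [mf fint] := fL.
  have fi mu : sub_psi_hypothesis psi mu ->
      mu.-integrable (sample_space psi) (EFin \o f).
    move=> muP; apply/integrableP; split; first exact/measurable_EFinP.
    exact: fint.
  split=> [f0|[nu nu0 fnu] mu muP].
    have [C C0 fC] := heavy_tail psi_ge0 dom_psi fL.
    (* The constant of [heavy_tail] makes [h] nonnegative on the negative half-line, and the bound 0
       for integrals of [f] becomes the bound 1 for those of [h]. *)
    pose h x := 1 + C^-1 * f x.
    have mh : measurable_fun (sample_space psi) h.
      by apply: measurable_funD => //; exact: measurable_funM.
    have h0 x : x <= 0 -> 0 <= h x.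
      move=> /fC fx; rewrite -(ler_pM2l C0) mulr0 /h mulrDr mulr1 mulrA.
      by rewrite divff ?gt_eqF// mul1r; lra.
    have hP mu : sub_psi_hypothesis psi mu ->
        (\int[mu]_(x in sample_space psi) (h x)%:E <= 1)%E.
      move=> muP; have [_ muX] := muP.
      rewrite (eq_integral (fun x => (cst 1%:E) x + (C^-1)%:E * (EFin \o f) x)%E)//.
      rewrite integralD//; first last.
      - by apply: integrableZl => //; exact: fi.
      - exact: finite_measure_integrable_cst.
      rewrite integral_cst// [X in (1 * X)%E]muX mul1e integralZl//; last exact: fi.
      rewrite geeDl//; apply: mule_ge0_le0; last exact: f0.
      by rewrite lee_fin invr_ge0 ltW.
    have [nu nu0 hnu] := dominating_mixture_sub_psi psi_closed psi_convex psi_ge0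
      psi0 lmax_gt0 dom_psi mh h0 hP.
    have Cge0 := ltW C0.
    have nuLam : nu (param_space lmax) = 1%E.
      rewrite -(setCK (param_space lmax)) probability_setC ?nu0 ?sube0//.
      exact: measurableC.
    (* Since f = C (h - 1), undoing the substitution multiplies the mixing measure by C. *)
    exists (mscale (NngNum Cge0) nu).
      by rewrite /= /mscale/= nu0 mule0.
    move=> x Xx.
    rewrite (integral_g_fun psi_closed psi_convex psi_ge0 psi0 lmax_gt0 dom_psi)//.
    have Ei := integrable_exp_fun psi_closed psi_convex psi_ge0 psi0 lmax_gt0
      dom_psi nu Xx.
    rewrite ge0_integral_mscale//; first last.
    - move=> l Ll; rewrite lee_fin.
      by have /andP[] := exp_fun_bound psi_convex psi_ge0 psi0 lmax_gt0 dom_psi Ll Xx.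
    - exact: measurable_int Ei.
    rewrite /mscale/= [X in (_ - C%:E * X)%E]nuLam mule1.
    have := hnu x Xx; rewrite -(fineK (integrable_fin_num mLam Ei)).
    rewrite -EFinM -EFinB !lee_fin /h => hI.
    rewrite lerBrDr -ler_pdivrMl// mulrDr mulVf ?gt_eqF//; lra.
  have [_ muX] := muP.
  (* For the converse, f <= H - nu Lam on the sample space, and the integral of [H] is at most nu
     Lam. *)
  set H := fun x => (\int[nu]_(l in param_space lmax) (exp_fun psi l x)%:E)%E.
  have H0 x : sample_space psi x -> (0 <= H x)%E.
    move=> Xx; apply: integral_ge0 => l Ll; rewrite lee_fin.
    by have /andP[] := exp_fun_bound psi_convex psi_ge0 psi0 lmax_gt0 dom_psi Ll Xx.
  have mH : measurable_fun (sample_space psi) H.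
    exact: (measurable_mixture psi_closed psi_convex psi_ge0 psi0 lmax_gt0 dom_psi).
  have HLam : (\int[mu]_(x in sample_space psi) H x <= nu (param_space lmax))%E.
    exact: (integral_mixture_le psi_closed psi_convex psi_ge0 psi0 lmax_gt0 dom_psi).
  have nufin : nu (param_space lmax) \is a fin_num by exact: fin_num_measure.
  have Hi : mu.-integrable (sample_space psi) H.
    apply/integrableP; split=> //.
    rewrite (eq_integral H) => [|x /set_mem Xx]; last by rewrite gee0_abs// H0.
    by apply: le_lt_trans HLam _; rewrite -ge0_fin_numE.
  set c := fine (nu (param_space lmax)).
  have ci : mu.-integrable (sample_space psi) (cst c%:E).
    exact: finite_measure_integrable_cst.
  apply: (@le_trans _ _ (\int[mu]_(x in sample_space psi) (H x - (cst c%:E) x))%E).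
    apply: le_integral => //; first exact: fi.
      exact: integrableB.
    move=> x /set_mem Xx; apply: le_trans (fnu x Xx) _.
    by rewrite (integral_g_fun psi_closed psi_convex psi_ge0 psi0 lmax_gt0 dom_psi)//= EFinN /c fineK.
  by rewrite (integralB mX Hi ci) integral_cst// [X in (_ - _ * X)%E]muX mule1 /c fineK// sube_le0.
apply/seteqP; split=> h.
  move=> hE; have [mh h0 hP] := hE; split=> //.
  (* Finiteness on the sample space lets the real-valued result apply to [fine \o h]. *)
  have hfin x : sample_space psi x -> ((fine (h x))%:E = h x)%E.
    move=> Xx; rewrite fineK// ge0_fin_numE ?h0//.
    exact: (e_variable_finite psi_convex psi_ge0 psi0 lmax_gt0 dom_psi hE).
  have [|||nu nu0 hnu] := dominating_mixture_sub_psi psi_closed psi_convex psi_ge0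
      psi0 lmax_gt0 dom_psi (h := fine \o h).
  - exact: (measurableT_comp (fine_measurable measurableT)).
  - by move=> x x0; apply: fine_ge0; apply: h0; exact: (nonpos_sample psi_ge0 dom_psi).
  - move=> mu muP; rewrite (eq_integral h); first exact: hP.
    by move=> x /set_mem Xx; exact: hfin.
  by exists nu => // x Xx; rewrite -hfin//; exact: hnu.
move=> [mh h0 [nu nu0 hnu]]; split=> // mu muP.
apply: (@le_trans _ _ (nu (param_space lmax))); last exact: probability_le1.
apply: le_trans (integral_mixture_le psi_closed psi_convex psi_ge0 psi0 lmax_gt0 dom_psi muP nu).
apply: ge0_le_integral => //.
exact: (measurable_mixture psi_closed psi_convex psi_ge0 psi0 lmax_gt0 dom_psi).
Qed.
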